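(* Let $n\ge 1$ and let $K\subseteq[n-1]$. For each integer $j$ with $0\le j\le\lfloor\frac{n-1}{2}\rfloor$, $$\gamma_{n,j,K}=|\widehat{W^K}(j)|.$$ Equivalently, $$h_{P_n(K)}(t)=\sum_{w\in\widehat{W^K}}t^{\operatorname{des}(w)}(1+t)^{n-1-2\operatorname{des}(w)}.$$
   Context: Notation: $[m]=\{1,\dots,m\}$, and $\mathfrak{S}_n$ is the symmetric group on $[n]$, with $w\in\mathfrak{S}_n$ written in one-line notation $w(1)w(2)\cdots w(n)$. Partitioned permutohedra. Fix $p=(p_1,\dots,p_n)\in\mathbb{R}^n$ with pairwise distinct entries and let $E\subset\mathbb{R}^n$ be the affine hyperplane of vectors whose coordinate sum equals $\sum_i p_i$. The permutohedron $P_n$ is the convex hull of the points $(p_{w(1)},\dots,p_{w(n)})$, $w\in\mathfrak{S}_n$. For $k\in[n-1]$ let $H(k)^{\le}=\{(x_1,\dots,x_n)\in E\mid x_k\le x_{k+1}\}$. For $K\subseteq[n-1]$ the partitioned permutohedron is $P_n(K)=P_n\cap\bigcap_{k\in K}H(k)^{\le}$. It is known that $P_n(K)$ is a simple polytope of dimension $n-1$. $h$-polynomial and $\gamma$-vector. Let $f_i$ be the number of $i$-dimensional faces of $P_n(K)$ for $0\le i\le n-1$ (so $f_{n-1}=1$), and set $h_{P_n(K)}(t)=\sum_{i=0}^{n-1}f_i(t-1)^i=\sum_{i=0}^{n-1}h_it^i$. Since $P_n(K)$ is simple, $h_i=h_{n-1-i}$ for all $i$, so there are uniquely determined integers $\gamma_{n,j,K}$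 ($0\le j\le\lfloor\frac{n-1}{2}\rfloor$) with $$h_{P_n(K)}(t)=\sum_{j=0}^{\lfloor\frac{n-1}{2}\rfloor}\gamma_{n,j,K}\,t^j(1+t)^{n-1-2j}.$$ Descents. A descent of $w\in\mathfrak{S}_n$ is an $i\in[n-1]$ with $w(i)>w(i+1)$; $\operatorname{Des}(w)$ is the set of descents and $\operatorname{des}(w)=|\operatorname{Des}(w)|$. $w$ has a double descent if $\{i,i+1\}\subseteq\operatorname{Des}(w)$ for some $i\in[n-2]$, and a final descent if $n-1\in\operatorname{Des}(w)$. The sets $W^K$, $\widehat{W^K}$. Let $W_K\le\mathfrak{S}_n$ be the subgroup generated by the transpositions $(k,k+1)$, $k\in K$. Permutations are composed from left to right, and $W^K$ is the set of minimal length representatives of the left cosets $wW_K$, the length of $w$ being its number of inversions. Explicitly, $w\in W^K$ if and only if for every $k\in K$ the letter $k$ appears to the left of $k+1$ in the one-line notation of $w$, i.e. $w^{-1}(k)<w^{-1}(k+1)$. Let $\widehat{\mathfrak{S}_n}$ be the set of $w\in\mathfrak{S}_n$ with no double descent and no final descent, $\widehat{W^K}=\widehat{\mathfrak{S}_n}\cap W^K$, and $\widehat{W^K}(j)=\{w\in\widehat{W^K}\mid\operatorname{des}(w)=j\}$. *)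

(* Defs.v *)
From mathcomp Require Import all_boot all_order all_algebra all_fingroup.
From mathcomp Require Import finmap boolp classical_sets cardinality reals.

Set Implicit Arguments.
Unset Strict Implicit.
Unset Printing Implicit Defensive.

Import Order.TTheory GRing.Theory Num.Theory.
Local Open Scope ring_scope.

(* Positions, letters and the elements of [n-1] are all shifted down by one:   *)
(* k : 'I_n.-1 stands for k+1 in [n-1], and [lo k], [hi k] : 'I_n stand for    *)
(* k+1, k+2 in [n].                                                            *)

Definition lo (n : nat) (k : 'I_n.-1) : 'I_n := widen_ord (leq_pred n) k.

Lemma hi_subproof (n : nat) (k : 'I_n.-1) : (k.+1 < n)%N.
Proof. by case: n k => [[]//|n] k; rewrite ltnS. Qed.

Definition hi (n : nat) (k : 'I_n.-1) : 'I_n := Ordinal (hi_subproof k).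

Section Polytopes.
Variables (R : realType) (n : nat).
Implicit Types P F : set 'rV[R]_n.

Definition dot (a x : 'rV[R]_n) : R := \sum_(i < n) a 0 i * x 0 i.

Definition conv_hull (I : finType) (v : I -> 'rV[R]_n) : set 'rV[R]_n :=
  [set x | exists c : I -> R,
     [/\ forall i, 0 <= c i, \sum_i c i = 1 & x = \sum_i c i *: v i]]%classic.

(* Taking a = 0 shows that a nonempty P is a face of itself; the empty face is *)
(* excluded.                                                                   *)
Definition is_face P F : Prop :=
  (F !=set0)%classic /\
  exists (a : 'rV[R]_n) (b : R),
    (forall x, P x -> dot a x <= b) /\
    F = [set x | P x /\ dot a x = b]%classic.

(* V is the direction of the affine hull of F.                                 *)
Definition has_dim F (d : nat) : Prop :=
  exists (x0 : 'rV[R]_n) (V : {vspace 'rV[R]_n}),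
    [/\ F x0,
        forall x, F x -> x - x0 \in V,
        forall U : {vspace 'rV[R]_n},
          (forall x, F x -> x - x0 \in U) -> (V <= U)%VS
      & \dim V = d].

(* [fset_set] of an infinite set is empty, but a polytope has finitely many    *)
(* faces.                                                                      *)
Definition f_number P (i : nat) : nat :=
  #|` fset_set [set F | is_face P F /\ has_dim F i]%classic|%fset.

Definition h_poly P : {poly int} :=
  \sum_(i < n) (f_number P i)%:Z *: ('X - 1) ^+ i.

End Polytopes.

Definition is_gamma_vector (d : nat) (h : {poly int})
    (g : {ffun 'I_(d./2).+1 -> int}) : Prop :=
  h = \sum_(j < (d./2).+1) g j *: ('X ^+ j * (1 + 'X) ^+ (d - 2 * j)).

(* The polynomials t^j (1+t)^(d-2j) are linearly independent, so there is at   *)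
(* most one such vector; the value is 0 if there is none.                      *)
Definition gamma_vector (d : nat) (h : {poly int}) :
    {ffun 'I_(d./2).+1 -> int} :=
  xget [ffun=> 0] [set g | is_gamma_vector h g]%classic.

Section PartitionedPermutohedron.
Variables (R : realType) (n : nat) (p : 'I_n -> R).

Definition hyperplaneE : set 'rV[R]_n :=
  [set x | \sum_(i < n) x 0 i = \sum_(i < n) p i]%classic.

Definition halfspace (k : 'I_n.-1) : set 'rV[R]_n :=
  [set x | hyperplaneE x /\ x 0 (lo k) <= x 0 (hi k)]%classic.

Definition permutohedron : set 'rV[R]_n :=
  conv_hull (fun w : 'S_n => \row_(i < n) p (w i)).

Definition partitioned_permutohedron (K : {set 'I_n.-1}) : set 'rV[R]_n :=
  [set x | permutohedron x /\ forall k, k \in K -> halfspace k x]%classic.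

End PartitionedPermutohedron.

Section Permutations.
Variable n : nat.
Implicit Types (w : 'S_n) (K : {set 'I_n.-1}).

Definition Des w : {set 'I_n.-1} := [set i | (w (hi i) < w (lo i))%N]%SET.

Definition des w : nat := #|Des w|.

Definition double_descent w : bool :=
  [exists i in Des w, exists j in Des w, j == i.+1 :> nat].

Definition final_descent w : bool :=
  [exists i in Des w, i.+1 == n.-1 :> nat].

Definition perm_length w : nat :=
  #|[set ij : 'I_n * 'I_n | (ij.1 < ij.2)%N && (w ij.2 < w ij.1)%N]%SET|.

Definition W_sub K : {set 'S_n} :=
  (<<[set tperm (lo k) (hi k) | k in K]%SET>>)%g.

(* In MathComp (s * t)%g is s followed by t.                                   *)
Definition W_min K : {set 'S_n} :=
  [set w | [forall v in (w *: W_sub K)%g, perm_length w <= perm_length v]%N]%SET.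

Definition S_hat : {set 'S_n} :=
  [set w | ~~ double_descent w & ~~ final_descent w]%SET.

Definition W_hat K : {set 'S_n} := (S_hat :&: W_min K)%SET.

Definition W_hat_des K (j : nat) : {set 'S_n} :=
  [set w in W_hat K | des w == j]%SET.

End Permutations.

(* Main.v *)
(* A face of P_n(K) is a pair of an ordered set partition of [n] and a set of
   equalities x_k = x_(k+1) inside its blocks. Listing each block increasingly,
   it becomes a permutation w in W^K with bars at all its descents, and an
   equality can only sit where w(i) = k, w(i+1) = k+1 with k in K. Summing over
   bars and equalities, w contributes to h(t) a factor 1 for each descent, 1 + t
   for each such K-adjacency and t for each other ascent.

   Replacing every letter of w by its K-block identifies W^K with the words of a
   given content, K-adjacencies becoming plateaus. Cutting a word at the first
   occurrence of its smallest letter x shows that the generating functions of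
   this weight and of t^des (1+t)^(n-1-2des) over words without double or final
   descents obey the same recursion G' = G + x + (1+t) x G' + t G x G' once the
   letters commute, so they agree.

   For the faces: P_n(K) is cut out by Rado's inequalities, the faces of a
   polyhedron correspond to the sets of constraints tight at some point, and the
   sets tight at a point of the permutohedron form a chain. Points with
   prescribed tight constraints come from a square linear system, invertible by
   Abel summation, with the inequalities given by a discrete minimum principle. *)

Require Import Defs.
From mathcomp Require Import all_boot all_order all_algebra all_fingroup.
From mathcomp Require Import finmap boolp classical_sets cardinality reals.
From mathcomp Require Import zify ring lra.
Import mathcomp.boot.fintype mathcomp.boot.finset.

Set Implicit Arguments.
Unset Strict Implicit.
Unset Printing Implicit Defensive.

Import Order.TTheory GRing.Theory Num.Theory.
Local Open Scope set_scope.
Local Open Scope ring_scope.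

(** * Two equidistributed weights on words *)

Section Words.
Variables (A : comNzRingType) (t : A) (N : nat).
Implicit Types (a b c i k n : nat) (u v : seq nat) (F G H : seq nat -> A).

(** Letters lie in [c, N). Moving the head letter into the argument of [F] keeps words as plain
    sequences, and discarding the smallest letter just raises [c]. *)
Fixpoint word_sum c n F : A :=
  if n is n'.+1 then \sum_(c <= a < N) word_sum c n' (fun v => F (a :: v))
  else F [::].

Lemma eq_word_sum c n F G :
    (forall u, size u = n -> all (fun a => c <= a)%N u -> F u = G u) ->
  word_sum c n F = word_sum c n G.
Proof.
elim: n F G => [|n IH] F G FG /=; first exact: FG.
rewrite !big_nat; apply: eq_bigr => a /andP[ca _]; apply: IH => u un uc.
by apply: FG; rewrite /= ?un // ca.
Qed.

Lemma word_sumS c n F :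
  word_sum c n.+1 F = \sum_(c <= a < N) word_sum c n (fun v => F (a :: v)).
Proof. by []. Qed.

Lemma word_sum0 c n : word_sum c n (fun=> 0) = 0.
Proof. by elim: n => [|n IH] //=; rewrite big1 // => a _; apply: IH. Qed.

Lemma word_sumD c n F G :
  word_sum c n (fun u => F u + G u) = word_sum c n F + word_sum c n G.
Proof.
elim: n F G => [|n IH] F G //=.
by rewrite -big_split; apply: eq_bigr => a _; apply: IH.
Qed.

Lemma word_sumZ c n x F : word_sum c n (fun u => x * F u) = x * word_sum c n F.
Proof.
elim: n F => [|n IH] F //=.
by rewrite mulr_sumr; apply: eq_bigr => a _; apply: IH.
Qed.

(** The first term collects the words without [c]; in the others [u] is the part before the first
    occurrence of [c]. *)
Lemma word_sum_split c n F : (c < N)%N ->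
  word_sum c n F = word_sum c.+1 n F +
    \sum_(i < n) word_sum c.+1 i (fun u =>
       word_sum c (n - i.+1) (fun v => F (u ++ c :: v))).
Proof.
move=> cN; elim: n F => [|n IH] F; first by rewrite big_ord0 addr0.
rewrite [LHS]/= big_ltn // big_ord_recl subSS subn0 addrCA; congr (_ + _).
under eq_bigr => a _ do rewrite IH.
rewrite big_split exchange_big /=; congr (_ + _).
Qed.

(** Words starting with [c] are isolated because the weights factor over the cut only for nonempty
    [u]. *)
Lemma word_sum_splitS c n F : (c < N)%N ->
  word_sum c n.+1 F = word_sum c.+1 n.+1 F + (word_sum c n (fun v => F (c :: v)) +
    \sum_(i < n) word_sum c.+1 i.+1 (fun u =>
       word_sum c (n - i.+1) (fun v => F (u ++ c :: v)))).
Proof. by move=> cN; rewrite word_sum_split // big_ord_recl subSS subn0. Qed.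

(* For the word of blocks of w in W^K, asc_weight is the contribution to h(t) of
   the faces coded by w, and hat_weight is t^des (1+t)^(n-1-2 des) if there is
   neither a double nor a final descent, 0 otherwise. The value 0 on the empty
   word makes the recursions below uniform. *)
Definition asc_wt a b : A :=
  if (a < b)%N then t else if a == b then 1 + t else 1.

Fixpoint asc_weight u : A :=
  if u is a :: v then
    if v is b :: _ then asc_wt a b * asc_weight v else 1
  else 0.

Fixpoint hat_weight u : A :=
  match u with
  | [::] => 0
  | [:: _] => 1
  | a :: (b :: v') as v =>
      if (a <= b)%N then (1 + t) * hat_weight v
      else if v' is d :: _ then if (b <= d)%N then t * hat_weight v' else 0
      else 0
  end.

(** The last letter of [u] exceeds [c], so the junction is a descent, of weight 1. *)
Lemma asc_weight_cat c u v : u != [::] -> all (fun a => c < a)%N u ->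
  asc_weight (u ++ c :: v) = asc_weight u * asc_weight (c :: v).
Proof.
elim: u => // a [|b u] IH _ /=.
  by move=> /andP[ca _]; rewrite mul1r /asc_wt ltnNge (ltnW ca) gtn_eqF // mul1r.
by move=> /andP[ca cu]; have /= -> := IH isT cu; rewrite mulrA.
Qed.

(** The descent into [c] and the step out of it give a single factor [t], so [c] drops out of the
    remaining word. With [v] empty the descent is final, which agrees with the value 0 on the empty
    word. The induction is strong because a descent consumes two letters. *)
Lemma hat_weight_cat c u v : u != [::] -> all (fun a => c < a)%N u ->
    all (fun a => c <= a)%N v ->
  hat_weight (u ++ c :: v) = t * hat_weight u * hat_weight v.
Proof.
have [k] := ubnP (size u); elim: k u v => // k IH [//|a [|b u]] v /=.
  move=> _ _ /andP[ca _]; rewrite leqNgt ca /=.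
  case: v => [|d v] /=; first by rewrite mulr0.
  by move=> /andP[-> _]; rewrite mulr1.
rewrite ltnS => uk _ /andP[ca /andP[cb cu]] cv; case: leqP => ab.
  by have /= -> := IH (b :: u) v uk isT; rewrite /= ?cb //; ring.
case: u uk cu => [_ _|d u uk cu] /=; first by rewrite leqNgt cb mulr0 mul0r.
case: leqP => bd; last by rewrite mulr0 mul0r.
by have /= -> := IH (d :: u) v (ltnW uk) isT cu cv; ring.
Qed.

(** The default [c.+1] of [head] switches the plateau term off when [v] is empty. *)
Lemma asc_weight_min c v : all (fun a => c <= a)%N v ->
  asc_weight (c :: v) = (v == [::])%:R + t * asc_weight v +
     (head c.+1 v == c)%:R * asc_weight v.
Proof.
case: v => [|b v] /=; first by rewrite !mulr0 !addr0.
move=> /andP[cb _]; rewrite /asc_wt eq_sym.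
by case: ltngtP cb => // cb _; rewrite ?cb ?mul1r ?mul0r; ring.
Qed.

Lemma hat_weight_min c v : all (fun a => c <= a)%N v ->
  hat_weight (c :: v) = (v == [::])%:R + (1 + t) * hat_weight v.
Proof.
case: v => [|b v] /=; first by rewrite mulr0 addr0.
by move=> /andP[-> _]; rewrite add0r.
Qed.

Arguments word_sum : simpl never.
Arguments asc_weight : simpl never.
Arguments hat_weight : simpl never.

(* With G, G' the generating functions of the weighted words over the letters
   > c, resp. >= c, and x the variable of c, this is the coefficient form of
   G' = G + x + (1 + t) x G' + t G x G': both weights satisfy it, for the
   second one up to commutation of the variables. *)
Definition min_letter_rec c n (wt : seq nat -> A) F :=
  word_sum c n.+1 (fun u => wt u * F u) =
    word_sum c.+1 n.+1 (fun u => wt u * F u) +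
    (n == 0)%:R * F [:: c] +
    (1 + t) * word_sum c n (fun v => wt v * F (c :: v)) +
    t * \sum_(i < n) word_sum c.+1 i.+1 (fun u => wt u *
          word_sum c (n - i.+1) (fun v => wt v * F (u ++ c :: v))).

Lemma word_sum_nil c n F :
  word_sum c n (fun v => (v == [::])%:R * F v) = (n == 0)%:R * F [::].
Proof.
case: n => [|n]; first by rewrite /word_sum !mul1r.
rewrite mul0r /word_sum /= big1 // => a _; rewrite -[RHS](word_sum0 c n).
by apply: eq_word_sum => u _ _; rewrite mul0r.
Qed.

Lemma word_sum_head c n F : (c < N)%N ->
  word_sum c n.+1 (fun v => (head c.+1 v == c)%:R * F v) =
  word_sum c n (fun v => F (c :: v)).
Proof.
move=> cN; rewrite word_sumS big_ltn //= [X in _ + X]big_nat.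
rewrite big1 => [|a /andP[ca _]].
  by rewrite addr0; apply: eq_word_sum => u _ _; rewrite eqxx mul1r.
rewrite -[RHS](word_sum0 c n); apply: eq_word_sum => u _ _.
by rewrite gtn_eqF // mul0r.
Qed.

Lemma hat_weight_rec c n F : (c < N)%N -> min_letter_rec c n hat_weight F.
Proof.
move=> cN; rewrite /min_letter_rec word_sum_splitS // -!addrA; congr (_ + _).
rewrite addrA; congr (_ + _).
  rewrite -(word_sum_nil c n (fun v => F (c :: v))) -word_sumZ -word_sumD.
  by apply: eq_word_sum => v _ cv; rewrite hat_weight_min //; ring.
rewrite mulr_sumr; apply: eq_bigr => i _;
rewrite -[in RHS]word_sumZ; apply: eq_word_sum => u ui cu.
rewrite mulrA -word_sumZ; apply: eq_word_sum => v _ cv.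
by rewrite hat_weight_cat //; [ring|case: u ui {cu}].
Qed.

Lemma asc_weight_rec c n F : (c < N)%N ->
    (forall u v, perm_eq u v -> F u = F v) ->
  min_letter_rec c n asc_weight F.
Proof.
move=> cN Fperm; rewrite /min_letter_rec word_sum_splitS // -!addrA.
congr (_ + _).
(* Relative to the recursion, words starting with [c] fall short by [Z] (the next letter exceeds
   [c]: weight [t] instead of [1 + t]), and words with a later first [c] have the excess [U] (that
   [c] is last or followed by another [c]). *)
pose Z := word_sum c n (fun v => (head c v != c)%:R * (asc_weight v * F (c :: v))).
pose U (i : 'I_n) := word_sum c.+1 i.+1 (fun u => asc_weight u *
  word_sum c (n - i.+1) (fun v => (v == [::])%:R * F (u ++ c :: v) +
     (head c.+1 v == c)%:R * (asc_weight v * F (u ++ c :: v)))).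
rewrite [X in X + _ = _](_ : _ = (n == 0)%:R * F [:: c] +
    (1 + t) * word_sum c n (fun v => asc_weight v * F (c :: v)) - Z); last first.
  rewrite -(word_sum_nil c n (fun v => F (c :: v))) -word_sumZ -word_sumD.
  rewrite -mulN1r -word_sumZ -word_sumD; apply: eq_word_sum => v _ cv.
  rewrite asc_weight_min //; case: v cv => [|b v] /=; first by rewrite /asc_weight eqxx => _; ring.
  by case: (b == c) => _ /=; ring.
rewrite [X in _ + X = _](_ : _ = \sum_i U i + t * \sum_(i < n)
    word_sum c.+1 i.+1 (fun u => asc_weight u *
      word_sum c (n - i.+1) (fun v => asc_weight v * F (u ++ c :: v)))); last first.
  rewrite mulr_sumr -big_split /=; apply: eq_bigr => i _.
  rewrite /U -word_sumZ -word_sumD.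
  apply: eq_word_sum => u ui cu; rewrite mulrCA -mulrDr -word_sumZ -word_sumD.
  rewrite -word_sumZ; apply: eq_word_sum => v _ cv.
  rewrite asc_weight_cat //; last by case: u ui {cu}.
  by rewrite asc_weight_min //; ring.
(* Moving the leading [c] of a word counted by [Z] up to the next [c], or to the end, gives a word
   counted by [U]; [F] has the same value on both. *)
suff -> : Z = \sum_i U i by ring.
rewrite {}/Z {}/U; case: n => [|n]; first by rewrite big_ord0 /word_sum /= eqxx mul0r.
rewrite (word_sum_splitS _ _ cN) big_ord_recr /= addrC; congr (_ + _).
  apply: eq_word_sum => u un cu.
  have -> : (head c u == c) = false.
    by case: u un cu => //= b u _ /andP[cb _]; rewrite gtn_eqF.
  rewrite subnn [word_sum c 0 _]/word_sum /= (gtn_eqF (ltnSn c)) mul0r addr0 !mul1r.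
  by rewrite (@Fperm (u ++ [:: c]) (c :: u)) // perm_catC.
rewrite (eq_word_sum (c := c) (G := fun=> 0)); last first.
  by move=> v _ _; rewrite /= eqxx mul0r.
rewrite word_sum0 add0r; apply: eq_bigr => i _.
apply: eq_word_sum => u ui cu.
have -> : (n.+1 - i.+1 = (n - i.+1).+1)%N by have := ltn_ord i; lia.
rewrite word_sumD word_sum_nil mul0r add0r word_sum_head // -word_sumZ.
apply: eq_word_sum => v _ cv.
rewrite (@Fperm (c :: u ++ c :: v) (u ++ c :: c :: v)); last first.
  by rewrite -(cat1s c (u ++ _)) -(cat1s c (c :: v)) perm_catCA.
rewrite asc_weight_cat //; last by case: u ui {cu}.
by case: u ui cu => //= b u _ /andP[cb _]; rewrite gtn_eqF // mul1r mulrA.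
Qed.

(** Induction on the number of letters, then on the length. In the quadratic term [v] is handled by
    the inner induction and [u] by the outer one; [F] stays symmetric in one part when the other is
    fixed or summed out. *)
Lemma asc_hat_weight_sum c n F : (c <= N)%N ->
    (forall u v, perm_eq u v -> F u = F v) ->
  word_sum c n (fun u => asc_weight u * F u) =
  word_sum c n (fun u => hat_weight u * F u).
Proof.
move=> cN; have [d Nd] : exists d, (N = c + d)%N by exists (N - c)%N; rewrite subnKC.
elim: d c cN Nd n F => [|d IHd] c cN Nd.
  by move=> [|n] F _; rewrite /word_sum /= ?mul0r // !big_geq // Nd addn0.
move=> n; elim/ltn_ind: n => -[|n] IHn F Fperm //.
have cltN : (c < N)%N by lia.
rewrite asc_weight_rec // hat_weight_rec // IHd //; last by lia.
rewrite IHn //; last by move=> u v uv; apply: Fperm; rewrite perm_cons.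
congr (_ + _ * _); apply: eq_bigr => i _.
rewrite -[RHS]IHd //; [|by lia|].
  apply: eq_word_sum => u _ _; congr (_ * _); apply: IHn; first by lia.
  by move=> v w vw; apply: Fperm; rewrite perm_cat2l perm_cons.
move=> u v uv; apply: eq_word_sum => w _ _; congr (_ * _); apply: Fperm.
by rewrite perm_cat2r.
Qed.

End Words.

(** * Sorting permutations and minimal coset representatives *)

Lemma card_ltn_ord (n m : nat) : (m <= n)%N -> #|[set i : 'I_n | (i < m)%N]| = m.
Proof.
move=> mn; rewrite cardsE -[RHS]card_ord -(card_image (f := widen_ord mn)).
  apply: eq_card => j; rewrite [LHS]inE; apply/idP/imageP => [jm|[k _ ->]].
    by exists (Ordinal jm) => //; apply: val_inj.
  exact: ltn_ord k.
by move=> a b /(congr1 val) /= /val_inj.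
Qed.

Section SortingPermutation.
Variables (d : Order.disp_t) (T : orderType d) (n : nat) (key : 'I_n -> T).

Definition sorts (w : 'S_n) := forall i j : 'I_n, (i < j)%N -> (key (w i) < key (w j))%O.

Lemma sorts_lt w i j : sorts w -> (key (w i) < key (w j))%O = (i < j)%N.
Proof.
move=> sw; case: (ltngtP i j) => [/sw //|/sw /lt_gtF //|/val_inj ->].
by rewrite ltxx.
Qed.

Lemma card_lt_sorts w i : sorts w -> #|[set j | (key j < key (w i))%O]| = i.
Proof.
move=> sw; have -> : [set j | (key j < key (w i))%O] = w @: [set j : 'I_n | (j < i)%N].
  apply/setP => j; rewrite -{1 2}(permKV w j) inE mem_imset; last exact: perm_inj.
  by rewrite inE sorts_lt.
by rewrite card_imset ?card_ltn_ord //; [exact: ltnW|exact: perm_inj].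
Qed.

Lemma sorts_unique w w' : sorts w -> sorts w' -> w = w'.
Proof.
move=> sw sw'; apply/permP => i; rewrite -[RHS](permKV w); congr (w _).
apply: val_inj; rewrite -[LHS](card_lt_sorts _ sw') -[RHS](card_lt_sorts _ sw).
by rewrite permKV.
Qed.

Lemma sorts_exists : injective key -> exists w, sorts w.
Proof.
move=> kinj.
have rk_lt i : (#|[set j | (key j < key i)%O]| < n)%N.
  rewrite -[ltnRHS]card_ord -cardsT; apply: proper_card.
  by apply/properP; split; [exact: subsetT|exists i; rewrite ?inE ?ltxx].
pose rk i := Ordinal (rk_lt i).
have rk_mono i j : (key i < key j)%O -> (rk i < rk j)%N.
  move=> ij; apply: proper_card; apply/properP; split.
    by apply/subsetP => k; rewrite !inE => /lt_trans; apply.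
  by exists i; rewrite !inE ?ltxx.
have rk_inj : injective rk.
  move=> i j ij; apply: kinj; case: (ltgtP (key i) (key j)) => // /rk_mono.
    by rewrite ij ltnn.
  by rewrite ij ltnn.
(* [rk] sends an index to its place in the sorted order, so the sorting permutation is its
   inverse. *)
exists (perm rk_inj)^-1%g => i j ij; rewrite ltNge; apply/negP.
rewrite le_eqVlt => /orP[/eqP/kinj/perm_inj ji|/rk_mono]; first by rewrite ji ltnn in ij.
by rewrite -!(permE rk_inj) !permKV ltnNge (ltnW ij).
Qed.

End SortingPermutation.

Section LoHi.
Variable n : nat.

Lemma val_lo (k : 'I_n.-1) : lo k = k :> nat. Proof. by []. Qed.

Lemma lo_inj : injective (@lo n).
Proof. by move=> i j /(congr1 val) /= /val_inj. Qed.

Lemma lo_hiP (a b : 'I_n) : b = a.+1 :> nat -> exists2 k, a = lo k & b = hi k.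
Proof.
move=> ba; have kn : (a < n.-1)%N by have := ltn_ord b; lia.
by exists (Ordinal kn); apply: val_inj => //=; rewrite ba.
Qed.

Lemma ord_lastVlo (j : 'I_n) : j.+1 = n \/ exists k, j = lo k.
Proof.
case: (eqVneq j.+1 n) => [|jn]; [by left|right].
have jn' : (j < n.-1)%N by have := ltn_ord j; lia.
by exists (Ordinal jn'); apply: val_inj.
Qed.

Lemma tperm_lo_hi (k : 'I_n.-1) (a : 'I_n) : tperm (lo k) (hi k) a =
  (if a == k :> nat then k.+1 else if a == k.+1 :> nat then k : nat else a) :> nat.
Proof.
case: tpermP => [->|->|/eqP/negPf aL /eqP/negPf aH] /=; rewrite ?eqxx //.
  by rewrite eqn_leq ltnn.
by rewrite -!val_eqE /= in aL aH; rewrite aL aH.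
Qed.

End LoHi.

Lemma sorts_step d (T : orderType d) n (key : 'I_n -> T) (w : 'S_n) :
  (forall k, (key (w (lo k)) < key (w (hi k)))%O) -> sorts key w.
Proof.
move=> kw i j; have [m] := ubnP j; elim: m j => // m IH j jm ij.
have jp : (j.-1 < n)%N by have := ltn_ord j; lia.
have [k k1 k2] : exists2 k, Ordinal jp = lo k & j = hi k.
  by apply: lo_hiP; rewrite /= prednK // (leq_ltn_trans _ ij).
rewrite k2; have : (i <= lo k)%N by rewrite -k1 /=; lia.
rewrite leq_eqVlt val_eqE => /predU1P[->|ik]; first exact: kw.
by apply: lt_trans (kw k); apply: IH => //; rewrite -k1 /=; lia.
Qed.

Section Blocks.
Variables (n : nat) (K : {set 'I_n.-1}).
Implicit Types (w : 'S_n) (a b : 'I_n) (k : 'I_n.-1).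

(* The orbits of the parabolic subgroup W_K on letters are the level sets of
   block_index. *)
Definition block_index (a : nat) : nat := #|[set k in ~: K | (k < a)%N]|.

Lemma block_index_leq (a b : nat) : (a <= b)%N -> (block_index a <= block_index b)%N.
Proof.
move=> ab; apply: subset_leq_card; apply/subsetP => k; rewrite !inE.
by move=> /andP[-> /leq_trans]; apply.
Qed.

Lemma block_index_max (a : nat) : (block_index a <= a)%N.
Proof.
elim: a => [|a IH]; first by rewrite leqn0 cards_eq0; apply/eqP/setP => k; rewrite !inE andbF.
apply: (@leq_trans (block_index a).+1) => //.
case: (ltnP a n.-1) => an; last first.
  apply: leqW; apply: subset_leq_card; apply/subsetP => k; rewrite !inE.
  by move=> /andP[-> _]; have := leq_trans (ltn_ord k) an.
rewrite /block_index -[leqRHS]add1n -(cards1 (Ordinal an)).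
apply: leq_trans (leq_of_leqif (leq_card_setU _ _)).
apply: subset_leq_card; apply/subsetP => k; rewrite !inE => /andP[->].
by rewrite ltnS leq_eqVlt -val_eqE.
Qed.

Lemma block_index_lo_hi k : (block_index (lo k) == block_index (hi k)) = (k \in K).
Proof.
apply/eqP/idP => [|kK].
  apply: contraPT => kK; apply/eqP; rewrite neq_ltn; apply/orP; left.
  apply: proper_card; apply/properP; split.
    by apply/subsetP => j; rewrite !inE /= => /andP[-> /ltnW]; rewrite ltnS.
  by exists k; rewrite !inE kK ?ltnS ?leqnn ?ltnn //= ltnn.
congr #|pred_of_set _|; apply/setP => j; rewrite !inE /= ltnS [(j <= k)%N]leq_eqVlt val_eqE.
by case: eqP => [->|//]; rewrite kK.
Qed.

Definition increasing_on_blocks w :=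
  [forall k in K, ((w^-1)%g (lo k) < (w^-1)%g (hi k))%N].

Lemma increasing_on_blocksP w :
  reflect (forall a b, (a < b)%N -> block_index a = block_index b ->
             ((w^-1)%g a < (w^-1)%g b)%N)
          (increasing_on_blocks w).
Proof.
apply: (iffP forall_inP) => [wK a b ab kab|wK k kK]; last first.
  by apply: wK => //; apply/eqP; rewrite block_index_lo_hi.
have [m] := ubnP b; elim: m b ab kab => // m IH b ab kab bm.
have bp : (b.-1 < n)%N by have := ltn_ord b; lia.
pose b' := Ordinal bp.
have [k b'k bk] : exists2 k, b' = lo k & b = hi k.
  by apply: lo_hiP; rewrite /= prednK // (leq_ltn_trans _ ab).
have ab' : (a <= b')%N by rewrite /=; lia.
have k1 := block_index_leq ab'.
have k2 : (block_index b' <= block_index b)%N by apply: block_index_leq => /=; lia.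
have kK : k \in K by rewrite -block_index_lo_hi -b'k -bk eqn_leq k2 -kab k1.
have lt := wK _ kK; rewrite -b'k -bk in lt.
move: ab'; rewrite leq_eqVlt val_eqE => /predU1P[-> //|ab'].
apply: ltn_trans lt; apply: IH => //; last by rewrite /=; lia.
by apply/eqP; rewrite eqn_leq k1 kab k2.
Qed.

Lemma block_index_W_sub w a : w \in W_sub K -> block_index (w a) = block_index a.
Proof.
pose G := [set u : 'S_n | [forall a : 'I_n, block_index (u a) == block_index a]].
have gG : group_set G.
  apply/group_setP; split=> [|u v]; first by rewrite inE; apply/forallP => b; rewrite perm1.
  rewrite !inE => /forallP uG /forallP vG; apply/forallP => b.
  by rewrite permM (eqP (vG _)) uG.
suff /subsetP sub : W_sub K \subset Group gG.
  by move=> /sub; rewrite inE => /forallP/(_ a)/eqP.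
rewrite gen_subG; apply/subsetP => _ /imsetP[k kK ->]; rewrite inE.
apply/forallP => b; case: tpermP => // ->; last rewrite eq_sym.
  by rewrite eq_sym block_index_lo_hi.
by rewrite eq_sym block_index_lo_hi.
Qed.

(** Right multiplication by [W_sub K] permutes letters inside blocks. If [hi k] precedes [lo k],
    swapping them loses that inversion and creates none. Conversely, if blocks are increasing, each
    inversion of [w] joins two different blocks and so persists throughout the coset. *)
Lemma W_minE w : (w \in W_min K) = increasing_on_blocks w.
Proof.
rewrite inE; apply/forall_inP/idP => [wmin|/increasing_on_blocksP wK].
  apply/forall_inP => k kK; rewrite ltnNge leq_eqVlt; apply/negP.
  case/predU1P => [/val_inj/perm_inj/(congr1 val) /=|lt]; first by lia.
  have := wmin (w * tperm (lo k) (hi k))%g.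
  rewrite mem_lcoset mulKg mem_gen; last by apply/imsetP; exists k.
  move=> /(_ isT); apply/negP; rewrite -ltnNge.
  apply: proper_card; apply/properP; split.
    apply/subsetP => -[i j]; rewrite !inE /= !permM => /andP[ij]; rewrite ij /=.
    have neq : w i != w j by rewrite (inj_eq perm_inj) neq_ltn ij.
    rewrite -val_eqE /= in neq; rewrite !tperm_lo_hi; case: eqP => [wj|_].
      by case: eqP => [|_]; [lia|case: eqP; lia].
    case: eqP => [wj|_]; last by case: eqP => [|_]; [lia|case: eqP; lia].
    case: eqP => [wi|_]; last by case: eqP; lia.
    have iE : i = (w^-1)%g (lo k) by apply: (@perm_inj _ w); rewrite permKV; apply: val_inj.
    have jE : j = (w^-1)%g (hi k) by apply: (@perm_inj _ w); rewrite permKV; apply: val_inj.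
    by rewrite iE jE ltnNge (ltnW lt) in ij.
  exists ((w^-1)%g (hi k), (w^-1)%g (lo k)); rewrite !inE /= ?permM !permKV.
    by rewrite lt /=.
  by rewrite tpermL tpermR /= [X in _ && X](_ : _ = false) ?andbF // ltnNge leqnSn.
move=> v; rewrite mem_lcoset => vw; apply: subset_leq_card.
apply/subsetP => -[i j]; rewrite !inE /= => /andP[ij wij]; rewrite ij /=.
have vE a : block_index (v a) = block_index (w a).
  by rewrite -(block_index_W_sub (w a) vw) -permM mulKVg.
have : (block_index (w j) < block_index (w i))%N.
  rewrite ltn_neqAle block_index_leq 1?ltnW // andbT; apply/eqP => /(wK _ _ wij).
  by rewrite !permK; lia.
by rewrite -!vE ltnNge => lt; rewrite ltnNge; apply: contra lt; apply: block_index_leq.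
Qed.

Lemma block_index_descent w k : increasing_on_blocks w ->
  (block_index (w (hi k)) < block_index (w (lo k)))%N = (w (hi k) < w (lo k))%N.
Proof.
move=> /increasing_on_blocksP wK; apply/idP/idP => [|lt].
  by rewrite !ltnNge; apply: contra; apply: block_index_leq.
rewrite ltn_neqAle block_index_leq 1?ltnW // andbT; apply/eqP => /(wK _ _ lt).
by rewrite !permK /=; lia.
Qed.

Definition adjacent_in w i := [exists k in K, (w (lo i) == lo k) && (w (hi i) == hi k)].

(** A letter strictly between [w (lo i)] and [w (hi i)] would belong to their block, hence sit
    strictly between two consecutive positions. *)
Lemma block_index_adjacent w i : increasing_on_blocks w ->
  (block_index (w (lo i)) == block_index (w (hi i))) = adjacent_in w i.
Proof.
move=> wK; apply/eqP/exists_inP => [kE|[k kK /andP[/eqP -> /eqP ->]]]; last first.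
  by apply/eqP; rewrite block_index_lo_hi.
have lt : (w (lo i) < w (hi i))%N.
  have := block_index_descent i wK; rewrite kE ltnn => /esym/negbT; rewrite -leqNgt.
  rewrite leq_eqVlt => /predU1P[/val_inj/perm_inj/(congr1 val) /=|//]; lia.
have bn : ((w (lo i)).+1 < n)%N by have := ltn_ord (w (hi i)); lia.
have [k ak bk] := lo_hiP (erefl : Ordinal bn = (w (lo i)).+1 :> nat).
have k1 : (block_index (w (lo i)) <= block_index (Ordinal bn))%N by apply: block_index_leq => /=.
have k2 : (block_index (Ordinal bn) <= block_index (w (hi i)))%N by apply: block_index_leq.
have kb : block_index (w (lo i)) = block_index (Ordinal bn).
  by apply/eqP; rewrite eqn_leq k1 kE k2.
have wKP := increasing_on_blocksP _ wK.
exists k; first by rewrite -block_index_lo_hi -ak -bk kb.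
rewrite -ak eqxx -bk eq_sym /=; apply/eqP/val_inj/eqP; rewrite eqn_leq lt leqNgt.
apply/negP => lt2; have := wKP _ _ (ltnSn _ : (w (lo i) < Ordinal bn)%N) kb.
have := wKP _ _ lt2 (etrans (esym kb) kE); rewrite !permK /=; lia.
Qed.

End Blocks.

(** * Descent sums over W^K as word sums *)

Section WeightsOfWords.
Variables (A : comNzRingType) (t : A).
Implicit Types (u v : seq nat).

Lemma asc_weight_prod u : u != [::] ->
  asc_weight t u = \prod_(i < (size u).-1) asc_wt t (nth 0 u i) (nth 0 u i.+1).
Proof.
case: u => // a v _; elim: v a => [|b v IH] a; first by rewrite big_ord0.
by rewrite big_ord_recl /=; have /= -> := IH b.
Qed.

Definition word_desc u i := (nth 0 u i.+1 < nth 0 u i)%N.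

Definition hat_word u := forall i, (i.+1 < size u)%N -> word_desc u i ->
  (i.+2 < size u)%N /\ ~~ word_desc u i.+1.

Definition word_des u := (\sum_(i < (size u).-1) word_desc u i)%N.

Lemma word_des_cons a b v :
  word_des (a :: b :: v) = ((b < a)%N + word_des (b :: v))%N.
Proof. by rewrite /word_des big_ord_recl. Qed.

Lemma hat_word_cons a b v : (a <= b)%N ->
  hat_word (a :: b :: v) <-> hat_word (b :: v).
Proof.
move=> ab; split=> hat i; first by move=> iv; apply: (hat i.+1).
case: i => [_|i]; first by rewrite /word_desc /= ltnNge ab.
by move=> iv; apply: hat.
Qed.

(** Giving the exponent by an equation avoids truncated subtraction and also bounds the number of
    descents by half the number of gaps. *)
Lemma hat_weightP u : u != [::] ->
  (hat_word u /\ exists2 e, ((word_des u).*2 + e = (size u).-1)%N &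
      hat_weight t u = t ^+ word_des u * (1 + t) ^+ e) \/
  (~ hat_word u /\ hat_weight t u = 0).
Proof.
have [k] := ubnP (size u); elim: k u => // k IH [//|a [|b v]].
  by move=> _ _; left; split=> //; exists 0%N; rewrite /word_des big_ord0 ?mul1r.
rewrite /= ltnS => uk _; case: leqP => [ab|ba].
  rewrite word_des_cons ltnNge ab add0n.
  have [[hat [e de E]]|[hat E]] := IH (b :: v) uk isT.
    left; split; first exact/hat_word_cons; exists e.+1.
      by rewrite addnS de.
    by have /= -> := E; rewrite exprS; ring.
  by right; split; [move/(hat_word_cons _ ab)|have /= -> := E; rewrite mulr0].
case: v uk => [|d v] uk /=.
  by right; split=> // /(_ 0%N isT); rewrite /word_desc /= ba => /(_ isT)[].
case: leqP => [bd|db]; last first.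
  by right; split=> // /(_ 0%N isT); rewrite /word_desc /= ba db => /(_ isT)[].
rewrite !word_des_cons ba ltnNge bd add0n add1n.
have hatE : hat_word [:: a, b, d & v] <-> hat_word (d :: v).
  rewrite -(hat_word_cons v bd); split=> hat i.
    by move=> iv; apply: (hat i.+1).
  case: i => [_ _|i iv]; last exact: hat.
  by rewrite /word_desc /= -leqNgt.
have [[hat [e de E]]|[hat E]] := IH (d :: v) (ltnW uk) isT.
  left; split; first exact/hatE; exists e; first by rewrite doubleS /= !addSn de.
  by have /= -> := E; rewrite exprS; ring.
by right; split; [move/hatE|have /= -> := E; rewrite mulr0].
Qed.

Lemma word_sum_tuple N n (F : seq nat -> A) :
  word_sum N 0 n F = \sum_(u : n.-tuple 'I_N) F (map val u).
Proof.
elim: n F => [|n IH] F.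
  by rewrite (big_pred1 [tuple]) // => u; apply/esym/eqP/tuple0.
rewrite word_sumS big_mkord; under eq_bigr => a _ do rewrite IH.
rewrite pair_bigA (reindex (fun p : 'I_N * n.-tuple 'I_N => cons_tuple p.1 p.2)) //.
exists (fun x : n.+1.-tuple 'I_N => (thead x, behead_tuple x)) => [[a x] _|x _] /=.
  by congr (_, _); apply: val_inj.
by rewrite [RHS]tuple_eta; apply: val_inj.
Qed.

End WeightsOfWords.

Section DescentSums.
Variables (n : nat) (K : {set 'I_n.-1}).
Implicit Types (w : 'S_n).

Lemma block_index_ltn (a : 'I_n) : (block_index K a < n)%N.
Proof. exact: leq_ltn_trans (block_index_max K a) (ltn_ord a). Qed.

Definition block_word w : n.-tuple 'I_n :=
  [tuple Ordinal (block_index_ltn (w i)) | i < n].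

Lemma nth_block_word w (i : 'I_n) : nth 0%N (map val (block_word w)) i = block_index K (w i).
Proof. by rewrite (nth_map (w i)) ?size_tuple // -tnth_nth tnth_mktuple. Qed.

(** Standardization: for [w] in [W_min K], the inverse of [w] lists the positions by block and,
    within a block, from left to right, so the block word determines it. *)
Lemma block_word_inj : {in W_min K &, injective block_word}.
Proof.
move=> w w'; rewrite !W_minE => wK w'K E.
pose key (i : 'I_n) := (block_index K (w i) * n + i)%N.
have kE i : block_index K (w i) = block_index K (w' i).
  by rewrite -!nth_block_word E.
have mono (v : 'S_n) : increasing_on_blocks K v ->
    (forall i, block_index K (w i) = block_index K (v i)) ->
    sorts key v^-1%g.
  move=> /increasing_on_blocksP vK wv a b ab; rewrite ltEnat /= /key !wv !permKV.
  have := block_index_leq K (ltnW ab); rewrite leq_eqVlt => /predU1P[kab|].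
    by rewrite kab ltn_add2l; apply: vK.
  by move: (ltn_ord ((v^-1)%g a)) (ltn_ord ((v^-1)%g b)); nia.
by apply: invg_inj; apply: sorts_unique (mono _ _ _) (mono _ _ _).
Qed.

Lemma block_word_imset :
  block_word @: W_min K = [set u : n.-tuple 'I_n | perm_eq (map val u) (map val (block_word 1))].
Proof.
apply/setP => u; apply/imsetP/idP => [[w _ ->]|].
  rewrite inE perm_map //; apply/tuple_permP; exists w.
  congr val; apply: eq_mktuple => i; rewrite tnth_mktuple perm1 //.
rewrite inE => /(perm_map_inj val_inj) /tuple_permP[w0 uE].
have {}uE i : tnth u i = block_index K (w0 i) :> nat.
  by rewrite (tnth_nth (tnth u i)) uE -tnth_nth tnth_mktuple tnth_mktuple perm1.
pose key (i : 'I_n) := (tnth u i * n + i)%N.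
have kinj : injective key.
  move=> i j /(congr1 (modn^~ n)); rewrite /key !modnMDl !modn_small //.
  exact: val_inj.
have [v vs] := sorts_exists kinj.
(* Both sides list the same multiset of block indices in weakly increasing order. *)
have tv (a : 'I_n) : block_index K (w0 (v a)) = block_index K a.
  pose s := [seq block_index K (w0 (v i)) | i <- enum 'I_n].
  pose s' := [seq block_index K (i : 'I_n) | i <- enum 'I_n].
  have sN (i : 'I_n) : nth 0%N s i = block_index K (w0 (v i)).
    by rewrite (nth_map i) ?size_enum_ord // nth_ord_enum.
  have s'N (i : 'I_n) : nth 0%N s' i = block_index K i.
    by rewrite (nth_map i) ?size_enum_ord // nth_ord_enum.
  have sE : s = s'.
    apply: (sorted_eq leq_trans anti_leq).
    - apply/(sortedP 0%N) => i; rewrite size_map size_enum_ord => i1.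
      have i0 : (i < n)%N by apply: ltnW.
      rewrite (sN (Ordinal i0)) (sN (Ordinal i1)).
      have := vs (Ordinal i0) (Ordinal i1) (ltnSn i); rewrite ltEnat /= /key !uE.
      move: (ltn_ord (v (Ordinal i0))) (ltn_ord (v (Ordinal i1))); nia.
    - apply/(sortedP 0%N) => i; rewrite size_map size_enum_ord => i1.
      have i0 : (i < n)%N by apply: ltnW.
      rewrite (s'N (Ordinal i0)) (s'N (Ordinal i1)).
      exact: block_index_leq.
    - rewrite /s /s' (map_comp (fun a : 'I_n => block_index K a) (fun i => w0 (v i))).
      apply: perm_map; apply: uniq_perm; rewrite ?enum_uniq //.
        by rewrite map_inj_uniq ?enum_uniq // => i j /perm_inj/perm_inj.
      move=> i; rewrite mem_enum inE; apply/mapP.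
      by exists ((v^-1)%g ((w0^-1)%g i)); rewrite ?mem_enum // !permKV.
  by rewrite -sN sE s'N.
have vK i : block_index K ((v^-1)%g i) = tnth u i.
  by rewrite uE -tv permKV.
exists v^-1%g; last first.
  by apply: eq_from_tnth => i; apply: val_inj; rewrite tnth_mktuple /= vK.
rewrite W_minE; apply/increasing_on_blocksP => a b ab kab; rewrite invgK.
have := vs a b ab; rewrite ltEnat /= /key -!vK !permK kab; lia.
Qed.

(** The indicator of the content is the symmetric [F] to which [asc_hat_weight_sum] is applied. *)
Lemma sum_block_word (A : comNzRingType) (G : seq nat -> A) :
  \sum_(w in W_min K) G (map val (block_word w)) =
  word_sum n 0 n (fun u => G u * (perm_eq u (map val (block_word 1)))%:R).
Proof.
rewrite word_sum_tuple -(big_imset (fun u : n.-tuple 'I_n => G (map val u)) block_word_inj).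
rewrite block_word_imset big_mkcond; apply: eq_bigr => u _; rewrite inE.
by case: ifP => _; rewrite ?mulr1 ?mulr0.
Qed.

Definition step_weight (A : comNzRingType) (t : A) w (i : 'I_n.-1) : A :=
  if (w (hi i) < w (lo i))%N then 1 else if adjacent_in K w i then 1 + t else t.

Lemma asc_weight_block_word (A : comNzRingType) (t : A) w :
    (0 < n)%N -> w \in W_min K ->
  asc_weight t (map val (block_word w)) = \prod_i step_weight t w i.
Proof.
rewrite W_minE => n0 wK; rewrite asc_weight_prod; last first.
  by rewrite -size_eq0 size_map size_tuple -lt0n.
rewrite size_map size_tuple; apply: eq_bigr => i _.
rewrite (nth_block_word w (lo i)) (nth_block_word w (hi i)).
rewrite /step_weight -(block_index_descent i wK) -(block_index_adjacent i wK) /asc_wt.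
by case: ltngtP.
Qed.

Lemma desc_block_word w (i : 'I_n.-1) : w \in W_min K ->
  word_desc (map val (block_word w)) i = (i \in Des w).
Proof.
rewrite W_minE => wK; rewrite /word_desc (nth_block_word w (lo i)) (nth_block_word w (hi i)).
by rewrite inE block_index_descent.
Qed.

Lemma des_block_word w : w \in W_min K -> word_des (map val (block_word w)) = des w.
Proof.
move=> wK; rewrite /word_des size_map size_tuple /des -sum1_card [RHS]big_mkcond.
by apply: eq_bigr => i _; rewrite desc_block_word //; case: (_ \in _).
Qed.

Lemma hat_block_word w : w \in W_min K ->
  reflect (hat_word (map val (block_word w))) (w \in S_hat n).
Proof.
move=> wK; rewrite inE /hat_word size_map size_tuple; apply: (iffP andP) => [[dd fd] i i1|hat].
  have iN : (i < n.-1)%N by lia.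
  rewrite (desc_block_word (Ordinal iN) wK) => iD.
  have i2 : (i.+1 < n.-1)%N.
    rewrite ltn_neqAle iN andbT; apply: contra fd => /eqP iE.
    by apply/exists_inP; exists (Ordinal iN) => //; apply/eqP.
  split; first by lia.
  rewrite (desc_block_word (Ordinal i2) wK); apply: contra dd => jD.
  by apply/exists_inP; exists (Ordinal iN) => //; apply/exists_inP; exists (Ordinal i2).
split; apply/negP => /exists_inP[i iD].
  move=> /exists_inP[j jD /eqP ji].
  have [] := hat i; first by have := ltn_ord i; lia.
    by rewrite desc_block_word.
  by rewrite -ji desc_block_word // jD.
move=> /eqP iE; have [] := hat i; first by have := ltn_ord i; lia.
  by rewrite desc_block_word.
by lia.
Qed.

Lemma hat_weight_block_word (A : comNzRingType) (t : A) w :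
    (0 < n)%N -> w \in W_min K ->
  hat_weight t (map val (block_word w)) =
    if w \in S_hat n then t ^+ des w * (1 + t) ^+ (n.-1 - 2 * des w) else 0.
Proof.
move=> n0 wK; have := @hat_weightP A t (map val (block_word w)).
rewrite -size_eq0 size_map size_tuple -lt0n => /(_ n0).
rewrite des_block_word // => -[[/(hat_block_word wK) -> [e eE ->]]|[hat ->]].
  by congr (_ * _ ^+ _); lia.
by case: (hat_block_word wK).
Qed.

Lemma leq_des_hat w : (0 < n)%N -> w \in W_hat K -> (des w <= n.-1./2)%N.
Proof.
rewrite inE => n0 /andP[wh wK].
(* Only the relation between descents and length is wanted, so any ring and any value of [t] will
   do. *)
have := @hat_weightP int 0 (map val (block_word w)).
rewrite -size_eq0 size_map size_tuple -lt0n => /(_ n0).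
rewrite des_block_word // => -[[_ [e eE _]]|[hat _]]; first by rewrite geq_half_double; lia.
by case: hat; apply/hat_block_word.
Qed.

Lemma sum_step_weight (A : comNzRingType) (t : A) : (0 < n)%N ->
  \sum_(w in W_min K) \prod_i step_weight t w i =
  \sum_(w in W_hat K) t ^+ des w * (1 + t) ^+ (n.-1 - 2 * des w).
Proof.
move=> n0; under eq_bigr => w wK do rewrite -asc_weight_block_word //.
rewrite (sum_block_word (asc_weight t)) asc_hat_weight_sum //; last first.
  by move=> u v uv; congr (_ %:R); congr nat_of_bool; apply: permPl.
rewrite -sum_block_word /W_hat; under eq_bigr => w wK do rewrite hat_weight_block_word //.
by rewrite -big_mkcondr; apply: eq_bigl => w; rewrite [in RHS]inE andbC.
Qed.

End DescentSums.

(** * Faces of a polyhedron given by inequalities *)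

Section Dot.
Variables (R : realType) (n : nat).
Implicit Types a x y : 'rV[R]_n.

Lemma dotDr a x y : dot a (x + y) = dot a x + dot a y.
Proof. by rewrite /dot -big_split; apply: eq_bigr => i _; rewrite mxE mulrDr. Qed.

Lemma dotZr a (k : R) x : dot a (k *: x) = k * dot a x.
Proof. by rewrite /dot mulr_sumr; apply: eq_bigr => i _; rewrite mxE mulrCA. Qed.

Lemma dotNr a x : dot a (- x) = - dot a x.
Proof. by rewrite -scaleN1r dotZr mulN1r. Qed.

Lemma dot_suml (I : Type) (r : seq I) (P : pred I) (a : I -> 'rV[R]_n) x :
  dot (\sum_(i <- r | P i) a i) x = \sum_(i <- r | P i) dot (a i) x.
Proof.
rewrite /dot exchange_big /=; apply: eq_bigr => j _.
by rewrite summxE mulr_suml.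
Qed.

Lemma dot_sumr (I : Type) (r : seq I) (P : pred I) a (x : I -> 'rV[R]_n) :
  dot a (\sum_(i <- r | P i) x i) = \sum_(i <- r | P i) dot a (x i).
Proof.
rewrite /dot exchange_big /=; apply: eq_bigr => j _.
by rewrite summxE mulr_sumr.
Qed.

End Dot.

Section HPolyhedron.
Variables (R : realType) (n : nat) (I : finType).
Variables (a : I -> 'rV[R]_n) (b : I -> R).
Implicit Types (x y z v : 'rV[R]_n) (T : {set I}).

Definition hpoly : set 'rV[R]_n :=
  [set x | forall c, dot (a c) x <= b c]%classic.

Definition tight x : {set I} := [set c | dot (a c) x == b c]%SET.

Definition hface T : set 'rV[R]_n :=
  [set x | hpoly x /\ T \subset tight x]%classic.

Lemma tightP x c : reflect (dot (a c) x = b c) (c \in tight x).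
Proof. by rewrite inE; apply: eqP. Qed.

Lemma hpoly_step_to_boundary x v :
    hpoly x -> (forall c, c \in tight x -> dot (a c) v = 0) ->
    (exists c, 0 < dot (a c) v) ->
  exists2 e, 0 < e & hpoly (x + e *: v) /\ tight x \proper tight (x + e *: v).
Proof.
move=> Px vT [c0 c0v].
(* Ratio test: the minimum over the constraints increasing along [v] is the first time at which one
   of them becomes tight. *)
pose slack c := (b c - dot (a c) x) / dot (a c) v.
have [c cv cmin] := @arg_minP _ R _ c0 (fun c => 0 < dot (a c) v) slack c0v.
have cNt : c \notin tight x by apply/negP => /vT cv0; rewrite cv0 ltxx in cv.
have bc : dot (a c) x < b c by rewrite lt_neqAle Px andbT; rewrite inE in cNt.
exists (slack c); first by rewrite /slack divr_gt0 ?subr_gt0.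
split.
  move=> d; rewrite dotDr dotZr; case: (ltP 0 (dot (a d) v)) => dv.
    have := cmin _ dv; rewrite {2}/slack ler_pdivlMr //; lra.
  have : 0 <= slack c by rewrite /slack divr_ge0 ?subr_ge0 // ltW.
  by have := Px d; nra.
apply/properP; split.
  by apply/subsetP => d dt; apply/tightP; rewrite dotDr dotZr (vT _ dt) mulr0 addr0; apply/tightP.
exists c => //; apply/tightP; rewrite dotDr dotZr /slack divfK ?gt_eqF //; lra.
Qed.

Lemma hpoly_step x v :
    hpoly x -> (forall c, c \in tight x -> dot (a c) v = 0) ->
  exists2 e, 0 < e & hpoly (x + e *: v).
Proof.
move=> Px vT; case: (pselect (exists c, 0 < dot (a c) v)) => [cv|Ncv].
  by have [e e0 [Pe _]] := hpoly_step_to_boundary Px vT cv; exists e.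
exists 1 => // c; rewrite dotDr dotZr mul1r.
have : dot (a c) v <= 0 by rewrite leNgt; apply/negP => cv; apply: Ncv; exists c.
by have := Px c; lra.
Qed.

Lemma tight_midpoint x y : hpoly x -> hpoly y ->
  hpoly (2^-1 *: (x + y)) /\ tight (2^-1 *: (x + y)) = tight x :&: tight y.
Proof.
move=> Px Py; split=> [c|].
  by rewrite dotZr dotDr; have := Px c; have := Py c; lra.
apply/setP => c; rewrite !inE dotZr dotDr; have := Px c; have := Py c => cy cx.
apply/eqP/andP => [xy|[/eqP -> /eqP ->]]; last by lra.
by split; apply/eqP; lra.
Qed.

(** The sum of the tight normals is a supporting functional: a sum of nonnegative slacks vanishes
    only if each of them does. *)
Lemma is_face_hface z : hpoly z -> is_face hpoly (hface (tight z)).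
Proof.
move=> Pz; split; first by exists z; split.
exists (\sum_(c in tight z) a c), (\sum_(c in tight z) b c); split=> [x Px|].
  by rewrite dot_suml; apply: ler_sum.
apply/seteqP; split=> x /= [Px xT]; split=> //.
  rewrite dot_suml; apply: eq_bigr => c /(subsetP xT) /tightP //.
apply/subsetP => c cz; apply/tightP/eqP; rewrite eq_sym -subr_eq0; apply/eqP.
have s0 : \sum_(c in tight z) (b c - dot (a c) x) = 0.
  by rewrite big_split /= sumrN -dot_suml xT subrr.
apply: (@psumr_eq0P R I (fun c => c \in tight z)
   (fun c => b c - dot (a c) x) _ s0) => // d _.
by rewrite subr_ge0.
Qed.

(* A point of F with the fewest tight constraints lies in the relative interior
   of F; from it one can move a little away from any point of hface. *)
Lemma is_faceP F :
  is_face hpoly F <-> exists2 z, hpoly z & F = hface (tight z).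
Proof.
split=> [[[x0 Fx0] [d [e [de FE]]]]|[z Pz ->]]; last exact: is_face_hface.
have [z Fz zmin] : exists2 z, F z & forall y, F y -> (#|tight z| <= #|tight y|)%N.
  have ex : exists k, `[< exists2 z, F z & #|tight z| = k >].
    by exists #|tight x0|; apply/asboolP; exists x0.
  case: (ex_minnP ex) => k /asboolP[z Fz zk] kmin; exists z => // y Fy.
  by rewrite zk; apply: kmin; apply/asboolP; exists y.
have FP y : F y -> hpoly y by rewrite FE => -[].
have Fd y : F y -> dot d y = e by rewrite FE => -[].
exists z; first exact: FP.
apply/seteqP; split=> y.
  move=> Fy; split; first exact: FP.
  have [Pm tm] := tight_midpoint (FP _ Fz) (FP _ Fy).
  have Fm : F (2^-1 *: (z + y)).
    by rewrite FE; split=> //; rewrite dotZr dotDr !Fd //; lra.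
  have := zmin _ Fm; rewrite tm => le.
  have /eqP <- : tight z :&: tight y == tight z by rewrite eqEcard subsetIl.
  exact: subsetIr.
move=> [Py /subsetP zy].
have zy0 c : c \in tight z -> dot (a c) (z - y) = 0.
  move=> cz; rewrite dotDr dotNr (tightP _ _ cz).
  by rewrite (tightP _ _ (zy _ cz)) subrr.
have [eps eps0 Pe] := hpoly_step (FP _ Fz) zy0.
rewrite FE; split=> //; apply/eqP; rewrite eq_le de //=.
have := de _ Pe; rewrite dotDr dotZr dotDr dotNr Fd //; nra.
Qed.

Lemma hface_inj y z : hpoly y -> hpoly z ->
  hface (tight y) = hface (tight z) -> tight y = tight z.
Proof.
move=> Py Pz E; apply/eqP; rewrite eqEsubset; apply/andP; split.
  by have [_ ->] : hface (tight y) z by rewrite E; split.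
by have [_ ->] : hface (tight z) y by rewrite -E; split.
Qed.

(** From [z] a small enough step along any vector of [V] stays in the face, so the face spans [V].
    As [has_dim] allows any base point, the origin is changed at the end. *)
Lemma has_dim_hface z (V : {vspace 'rV[R]_n}) d :
    hpoly z ->
    (forall v, (v \in V) <-> forall c, c \in tight z -> dot (a c) v = 0) ->
  has_dim (hface (tight z)) d <-> d = \dim V.
Proof.
move=> Pz VE; set F := hface _.
have Fz : F z by split.
have FV x : F x -> x - z \in V.
  move=> [Px /subsetP zx]; apply/VE => c cz; rewrite dotDr dotNr.
  by rewrite (tightP _ _ cz) (tightP _ _ (zx _ cz)) subrr.
have VU (U : {vspace 'rV[R]_n}) : (forall x, F x -> x - z \in U) -> (V <= U)%VS.
  move=> FU; apply/subvP => v /VE vz.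
  have [e e0 Pe] := hpoly_step Pz vz.
  have : F (z + e *: v).
    split=> //; apply/subsetP => c cz; apply/tightP; rewrite dotDr dotZr vz //.
    by rewrite mulr0 addr0; apply/tightP.
  move=> /FU; rewrite addrAC subrr add0r => eU.
  by rewrite -(scale1r v) -(mulVf (lt0r_neq0 e0)) -scalerA memvZ.
split=> [[x0 [U [Fx0 FU Umin <-]]]|->]; last by exists z, V; split.
congr (\dim _); apply/eqP; rewrite eqEsubv; apply/andP; split.
  apply: Umin => x Fx; have -> : x - x0 = (x - z) - (x0 - z) by rewrite opprB addrA subrK.
  by rewrite memvB ?FV.
apply: VU => x Fx; have -> : x - z = (x - x0) - (z - x0) by rewrite opprB addrA subrK.
by rewrite memvB ?FU.
Qed.

(** Turns counting faces into counting codes: [T] has to be a bijection from [A] onto the tight sets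
    that occur, and [dm] the dimension of the common kernel of the tight normals. *)
Lemma f_number_hpoly (J : finType) (A : {set J}) (T : J -> {set I})
    (dm : J -> nat) :
    {in A &, injective T} ->
    (forall z, hpoly z -> exists2 j, j \in A & tight z = T j) ->
    (forall j, j \in A -> exists2 z, hpoly z & tight z = T j) ->
    (forall j, j \in A -> exists2 V : {vspace 'rV[R]_n}, \dim V = dm j &
       forall v, (v \in V) <-> forall c, c \in T j -> dot (a c) v = 0) ->
  forall d, f_number hpoly d = #|[set j in A | dm j == d]%SET|.
Proof.
move=> Tinj TP AT dimT d; rewrite /f_number.
have -> : [set F | is_face hpoly F /\ has_dim F d]%classic =
    [set` [fset hface (T j) | j in [set j in A | dm j == d]%SET]%fset]%classic.
  apply/seteqP; split=> F /=.
    move=> [/is_faceP[z Pz ->] zd]; have [j jA zT] := TP _ Pz.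
    have [V Vd VE] := dimT _ jA; rewrite -zT in VE.
    move/(has_dim_hface _ Pz VE) : zd => zd.
    by apply/imfsetP; exists j; rewrite ?zT //= inE jA -Vd zd eqxx.
  move=> /imfsetP[j /=]; rewrite inE => /andP[jA /eqP jd] ->.
  have [z Pz zT] := AT _ jA; have [V Vd VE] := dimT _ jA; rewrite -zT in VE *.
  by split; [exact: is_face_hface|apply/(has_dim_hface _ Pz VE); rewrite Vd].
rewrite set_fsetK card_in_imfset /= ?cardE //.
move=> i j /=; rewrite !inE => /andP[iA _] /andP[jA _].
have [y Py yT] := AT _ iA; have [z Pz zT] := AT _ jA.
rewrite -yT -zT => /hface_inj E; apply: Tinj => //.
by rewrite -yT -zT E.
Qed.

End HPolyhedron.

(** * Inequalities of the partitioned permutohedron *)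

Lemma sum_setT (V : nmodType) (T : finType) (F : T -> V) :
  \sum_(i in setT) F i = \sum_i F i.
Proof. by apply: eq_bigl => i; rewrite inE. Qed.

Section PrefixSums.
Variables (R : realType) (n : nat).
Implicit Types (y : 'I_n -> R) (S : {set 'I_n}).

Definition prefix_sum y (m : nat) : R := \sum_(i < n | (i < m)%N) y i.

Lemma prefix_sum0 y : prefix_sum y 0 = 0.
Proof. by rewrite /prefix_sum big_pred0. Qed.

Lemma prefix_sumS y (i : 'I_n) : prefix_sum y i.+1 = prefix_sum y i + y i.
Proof.
rewrite /prefix_sum (bigD1 i) ?ltnSn //= addrC; congr (_ + _).
by apply: eq_bigl => j; rewrite ltnS ltn_neqAle andbC val_eqE.
Qed.

Lemma prefix_sum_full y : prefix_sum y n = \sum_i y i.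
Proof. by apply: eq_bigl => i; rewrite ltn_ord. Qed.

(** After subtracting the entry at index [#|S|], the first [#|S|] terms are nonpositive and the
    others nonnegative, so the prefix is the cheapest choice of its size. *)
Lemma prefix_sum_leq y S : (forall i j : 'I_n, (i < j)%N -> y i <= y j) ->
  prefix_sum y #|S| <= \sum_(i in S) y i.
Proof.
move=> ymono.
have : (#|S| <= n)%N by rewrite -[leqRHS]card_ord max_card.
rewrite leq_eqVlt => /predU1P[Sn|Sn].
  rewrite Sn prefix_sum_full; have -> : S = setT; last by rewrite sum_setT.
  by apply/eqP; rewrite eqEcard subsetT cardsT card_ord Sn /=.
pose c := y (Ordinal Sn).
have : \sum_(i < n | (i < #|S|)%N) (y i - c) <= \sum_(i in S) (y i - c).
  rewrite big_mkcond [leRHS]big_mkcond /=; apply: ler_sum => i _.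
  case: (ltnP i #|S|) => iS.
    have : y i <= c by apply: ymono.
    by case: ifP => _; lra.
  have : c <= y i.
    move: iS; rewrite leq_eqVlt => /predU1P[iS|iS]; last exact: ymono.
    by rewrite /c (_ : Ordinal Sn = i) //; apply: val_inj.
  by case: ifP => _; lra.
rewrite /prefix_sum; have AE (F : 'I_n -> R) :
    \sum_(i < n | (i < #|S|)%N) F i = \sum_(i in [set i : 'I_n | (i < #|S|)%N]) F i.
  by apply: eq_bigl => i; rewrite inE.
by rewrite !AE !sumrB !sumr_const (card_ltn_ord (ltnW Sn)) lerD2r.
Qed.

End PrefixSums.

Section ConvHull.
Variables (R : realType) (n : nat) (I : finType) (v : I -> 'rV[R]_n).

Lemma conv_hull_vertex i : conv_hull v (v i).
Proof.
exists (fun j => (j == i)%:R); split=> [j||]; first exact: ler0n.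
  by rewrite (bigD1 i) //= eqxx big1 ?addr0 // => j /negPf ->.
by rewrite (bigD1 i) //= eqxx scale1r big1 ?addr0 // => j /negPf ->; rewrite scale0r.
Qed.

Lemma conv_hull_convex x y (a b : R) : 0 <= a -> 0 <= b -> a + b = 1 ->
  conv_hull v x -> conv_hull v y -> conv_hull v (a *: x + b *: y).
Proof.
move=> a0 b0 ab [c [c0 c1 ->]] [d [d0 d1 ->]].
exists (fun i => a * c i + b * d i); split=> [i||].
- by rewrite addr_ge0 ?mulr_ge0.
- by rewrite big_split -!mulr_sumr c1 d1 !mulr1.
rewrite !scaler_sumr -big_split; apply: eq_bigr => i _.
by rewrite scalerDl !scalerA.
Qed.

Lemma conv_hull_dot a (b : R) : (forall i, dot a (v i) <= b) ->
  forall x, conv_hull v x -> dot a x <= b.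
Proof.
move=> vb x [c [c0 c1 ->]]; rewrite dot_sumr -[b]mul1r -c1 mulr_suml.
by apply: ler_sum => i _; rewrite dotZr ler_wpM2l.
Qed.

End ConvHull.

(** * Rado's inequalities *)

Section HDescription.
Variables (R : realType) (n : nat) (p : 'I_n -> R) (tau : 'S_n).
Hypothesis tauP : sorts p tau.
Implicit Types (K : {set 'I_n.-1}) (S : {set 'I_n}) (x v : 'rV[R]_n).

Definition sorted_p (i : 'I_n) := p (tau i).
Definition low_sum (m : nat) : R := prefix_sum sorted_p m.

Definition constraint := option ({set 'I_n} + 'I_n.-1)%type.

(* None and inl setT together cut out the hyperplane E; the constraints inr k
   with k outside K are void. *)
Definition constr_normal K (c : constraint) : 'rV[R]_n :=
  match c with
  | None => const_mx 1
  | Some (inl B) => \row_i - (i \in B)%:R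
  | Some (inr k) =>
      if k \in K then delta_mx 0 (lo k) - delta_mx 0 (hi k) else 0
  end.

Definition constr_bound (c : constraint) : R :=
  match c with
  | None => low_sum n
  | Some (inl B) => - low_sum #|B|
  | Some (inr _) => 0
  end.

Lemma dot_delta i x : dot (delta_mx 0 i) x = x 0 i.
Proof.
rewrite /dot (bigD1 i) //= mxE !eqxx mul1r big1 ?addr0 // => j /negPf ji.
by rewrite mxE ji mul0r.
Qed.

Lemma sum_delta (P : pred 'I_n) k :
  \sum_(i | P i) (delta_mx 0 k : 'rV[R]_n) 0 i = (P k)%:R.
Proof.
rewrite big_mkcond (bigD1 k) //= mxE !eqxx big1 ?addr0 => [|i /negPf ik].
  by case: (P k).
by rewrite mxE ik andbF if_same.
Qed.

Lemma dot_total K x : dot (constr_normal K None) x = \sum_i x 0 i.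
Proof. by apply: eq_bigr => i _; rewrite mxE mul1r. Qed.

Lemma dot_subset K S x : dot (constr_normal K (Some (inl S))) x = - \sum_(i in S) x 0 i.
Proof.
rewrite /dot -sumrN [RHS]big_mkcond; apply: eq_bigr => i _; rewrite mxE mulNr.
by case: (i \in S); rewrite ?mul1r ?mul0r ?oppr0.
Qed.

Lemma dot_step K k x : dot (constr_normal K (Some (inr k))) x =
  if k \in K then x 0 (lo k) - x 0 (hi k) else 0.
Proof.
rewrite /=; case: ifP => _; last by rewrite /dot big1 // => i _; rewrite mxE mul0r.
rewrite -!dot_delta /dot -sumrB; apply: eq_bigr => i _.
by rewrite !mxE mulrBl.
Qed.

Lemma hpolyP K x : hpoly (constr_normal K) constr_bound x <->
  [/\ \sum_i x 0 i = low_sum n, forall S, low_sum #|S| <= \sum_(i in S) x 0 i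
    & forall k, k \in K -> x 0 (lo k) <= x 0 (hi k)].
Proof.
split=> [Px|[xT xS xK]].
  have xS S : low_sum #|S| <= \sum_(i in S) x 0 i.
    by have := Px (Some (inl S)); rewrite dot_subset lerN2.
  split=> // [|k kK].
    apply/eqP; rewrite eq_le -(dot_total K) (Px None) dot_total /=.
    by have := xS setT; rewrite cardsT card_ord sum_setT.
  by have := Px (Some (inr k)); rewrite dot_step kK subr_le0.
move=> [[S|k]|]; rewrite ?dot_subset ?dot_step ?dot_total /= ?lerN2 ?xT //.
by case: ifP => // /xK; rewrite subr_le0.
Qed.

Lemma sorted_p_mono (i j : 'I_n) : (i < j)%N -> sorted_p i < sorted_p j.
Proof. exact: tauP. Qed.

Lemma low_sumS (i : 'I_n) : low_sum i.+1 = low_sum i + sorted_p i.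
Proof. exact: prefix_sumS. Qed.

Section TightSets.
Variable x : 'rV[R]_n.
Hypothesis xS : forall S, low_sum #|S| <= \sum_(i in S) x 0 i.

(** Removing [i] from the tight set bounds x_i above by the [#|S|]-th smallest entry of [p]; adding
    [j] bounds x_j below by the next entry. *)
Lemma tight_subset_lt S i j : \sum_(i in S) x 0 i = low_sum #|S| ->
  i \in S -> j \notin S -> x 0 i < x 0 j.
Proof.
move=> St iS jS.
have jn : (#|S| < n)%N.
  rewrite -[ltnRHS]card_ord -cardsT; apply: proper_card; apply/properP; split.
    exact: subsetT.
  by exists j.
have Si : #|S| = #|S :\ i|.+1 by rewrite (cardsD1 i S) iS add1n.
have i0 : (#|S :\ i| < n)%N by lia.
have xi : x 0 i <= sorted_p (Ordinal i0).
  have := xS (S :\ i); have := low_sumS (Ordinal i0); rewrite /= -Si -St (big_setD1 i) //=; lra.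
have xj : sorted_p (Ordinal jn) <= x 0 j.
  have := xS (j |: S); have := low_sumS (Ordinal jn).
  by rewrite cardsU1 jS add1n /= big_setU1 //= St; lra.
apply: le_lt_trans xi _; apply: lt_le_trans xj.
by apply: sorted_p_mono => /=; rewrite Si.
Qed.

Lemma tight_subset_chain S S' :
    \sum_(i in S) x 0 i = low_sum #|S| -> \sum_(i in S') x 0 i = low_sum #|S'| ->
  S \subset S' \/ S' \subset S.
Proof.
move=> St S't; case: (boolP (S \subset S')) => [|/subsetPn[i iS iS']]; first by left.
right; apply/subsetP => j jS'; apply: contraT => jS.
by have := lt_trans (tight_subset_lt St iS jS) (tight_subset_lt S't jS' iS'); rewrite ltxx.
Qed.

End TightSets.
Lemma tight_inl K S x :
  (Some (inl S) \in tight (constr_normal K) constr_bound x) = (\sum_(i in S) x 0 i == low_sum #|S|).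
Proof. by rewrite inE dot_subset eqr_opp. Qed.

Lemma tight_inr K k x :
  (Some (inr k) \in tight (constr_normal K) constr_bound x) =
  (k \notin K) || (x 0 (lo k) == x 0 (hi k)).
Proof. by rewrite inE dot_step /=; case: ifP => _ /=; rewrite ?subr_eq0 ?eqxx. Qed.

Lemma tight_None K x :
  (None \in tight (constr_normal K) constr_bound x) = (\sum_i x 0 i == low_sum n).
Proof. by rewrite inE dot_total. Qed.

Lemma sum_prefix (w : 'S_n) (y : 'I_n -> R) m : (m <= n)%N ->
  \sum_(a in [set a | ((w^-1)%g a < m)%N]) y a = prefix_sum (y \o w) m.
Proof.
move=> mn; rewrite (reindex_inj (@perm_inj _ w)); apply: eq_bigl => i.
by rewrite inE permK.
Qed.

Lemma card_prefix (w : 'S_n) m : (m <= n)%N ->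
  #|[set a | ((w^-1)%g a < m)%N]| = m.
Proof.
move=> mn; have -> : [set a | ((w^-1)%g a < m)%N] = w @: [set i : 'I_n | (i < m)%N].
  apply/setP => a; rewrite -{2}(permKV w a) mem_imset; last exact: perm_inj.
  by rewrite !inE.
by rewrite card_imset ?card_ltn_ord //; exact: perm_inj.
Qed.

(** The hard half of Rado's theorem, by induction on the number of slack constraints; with [set0]
    all step constraints are void. *)
Lemma permutohedron_hpoly x : hpoly (constr_normal set0) constr_bound x -> permutohedron p x.
Proof.
have [m] := ubnP #|~: tight (constr_normal set0) constr_bound x|.
elim: m x => // m IH x xm Px; have [xT xS _] := (hpolyP set0 x).1 Px.
case: (pselect (exists i j : 'I_n, i != j /\ forall S,
    \sum_(a in S) x 0 a = low_sum #|S| -> (i \in S) = (j \in S))) => [[i [j [ij sep]]]|nsep].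
  (* No tight set separates the two coordinates, so moving along their difference keeps every tight
     constraint until a new one is reached. *)
  have step i' j' : i' != j' ->
      (forall S, \sum_(a in S) x 0 a = low_sum #|S| -> (i' \in S) = (j' \in S)) ->
      exists2 e : R, 0 < e &
        permutohedron p (x + e *: (delta_mx 0 i' - delta_mx 0 j')).
    move=> ij' sep'; set v := _ - _.
    have dv S : dot (constr_normal set0 (Some (inl S))) v = (j' \in S)%:R - (i' \in S)%:R.
      by rewrite dotDr dotNr !dot_subset !(sum_delta (mem S)) opprK addrC.
    have [|| e e0 [Pe te]] := hpoly_step_to_boundary (v := v) Px.
    - move=> [[S|k]|] ct.
      + by rewrite dv (sep' S) ?subrr //; move: ct; rewrite tight_inl => /eqP.
      + by rewrite dot_step inE.
      + by rewrite dotDr dotNr !dot_total !(sum_delta xpredT) subrr.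
    - exists (Some (inl [set j'])); rewrite dv !inE eqxx (negPf ij') subr0; exact: ltr01.
    exists e => //; apply: IH => //; rewrite ltnS in xm; apply: leq_trans xm.
    by apply: proper_card; rewrite properC.
  have [e e0 Pe] := step i j ij sep.
  have ji : j != i by rewrite eq_sym.
  have [f f0 Pf] := step j i ji (fun S St => esym (sep S St)).
  have ef : e + f != 0 by rewrite gt_eqF // addr_gt0.
  (* [x] lies between the boundary points reached in the two opposite directions. *)
  have -> : x = (f / (e + f)) *: (x + e *: (delta_mx 0 i - delta_mx 0 j)) +
                (e / (e + f)) *: (x + f *: (delta_mx 0 j - delta_mx 0 i)).
    rewrite -(opprB (delta_mx 0 i)); move: (delta_mx 0 i - delta_mx 0 j) => d.
    rewrite scalerN !scalerDr !scalerN !scalerA addrACA -scalerDl -mulrDl.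
    rewrite (addrC f) divff // scale1r (_ : f / (e + f) * e = e / (e + f) * f); last by ring.
    by rewrite subrr addr0.
  apply: conv_hull_convex Pe Pf; rewrite ?divr_ge0 ?addr_ge0 ?(ltW e0) ?(ltW f0) //.
  by rewrite -mulrDl addrC divff.
(* Otherwise tight sets separate all pairs of coordinates; these are then distinct, and [x] turns
   out to be a vertex. *)
have sep i j : i != j -> exists2 S : {set 'I_n},
    \sum_(a in S) x 0 a = low_sum #|S| & (i \in S) != (j \in S).
  move=> ij; apply: contrapT => H; apply: nsep; exists i, j; split=> // S St.
  by apply/eqP; apply: contrapT => /negP ne; apply: H; exists S.
have [w xw] : exists w, sorts (fun i => x 0 i) w.
  apply: sorts_exists => i j xij; apply/eqP; apply: contrapT => /negP /sep[S St].
  case: (boolP (i \in S)); case: (boolP (j \in S)) => // jS iS _.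
    by have := tight_subset_lt xS St iS jS; rewrite xij ltxx.
  by have := tight_subset_lt xS St jS iS; rewrite xij ltxx.
have xwle (i j : 'I_n) : (i <= j)%N -> x 0 (w i) <= x 0 (w j).
  by rewrite leNgt (sorts_lt _ _ xw) -leqNgt.
(* A tight set takes the smallest coordinates first, so the one separating two consecutive positions
   is exactly the prefix ending between them. *)
have pw (k : 'I_n.-1) : prefix_sum (fun i => x 0 (w i)) k.+1 = low_sum k.+1.
  have [] := sep (w (lo k)) (w (hi k)).
    by rewrite (inj_eq perm_inj) -val_eqE /= neq_ltn ltnSn.
  move=> S St neS.
  have [loS hiS] : w (lo k) \in S /\ w (hi k) \notin S.
    move: neS; case: (boolP (w (lo k) \in S)); case: (boolP (w (hi k) \in S)) => // hS lS _.
    have := tight_subset_lt xS St hS lS.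
    by rewrite ltNge xwle //= leqnSn.
  have kn : (k.+1 <= n)%N by have := ltn_ord (hi k); rewrite /=; lia.
  have SE : S = [set a | ((w^-1)%g a < k.+1)%N].
    apply/setP => a; rewrite inE -{1}(permKV w a); set i := (w^-1)%g a.
    rewrite ltnS; apply/idP/idP => [iS|ik].
      rewrite leqNgt; apply: contraL iS => ki; apply: contra hiS => iS.
      apply: contraT => hS; have := tight_subset_lt xS St iS hS.
      by rewrite ltNge xwle.
    apply: contraT => iS; have := tight_subset_lt xS St loS iS.
    by rewrite ltNge xwle.
  by rewrite -(sum_prefix w (fun a => x 0 a)) // -SE St SE card_prefix.
have xE i : x 0 (w i) = sorted_p i.
  have ph (k : nat) : (k <= n)%N -> prefix_sum (fun i => x 0 (w i)) k = low_sum k.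
    case: k => [_|k kn]; first by rewrite /low_sum !prefix_sum0.
    move: kn; rewrite leq_eqVlt => /predU1P[->|kn].
      rewrite prefix_sum_full -xT; symmetry; exact: (reindex_inj (@perm_inj _ w)).
    have kn' : (k < n.-1)%N by lia.
    exact: (pw (Ordinal kn')).
  have := prefix_sumS (fun i => x 0 (w i)) i; rewrite !ph //; last exact: ltnW.
  by rewrite low_sumS; lra.
have -> : x = \row_i p ((w^-1 * tau)%g i); last exact: conv_hull_vertex.
by apply/rowP => i; rewrite mxE permM -{1}(permKV w i) xE.
Qed.
Lemma low_sum_full : low_sum n = \sum_i p i.
Proof. by rewrite [LHS]prefix_sum_full [RHS](reindex_inj (@perm_inj _ tau)). Qed.

Lemma low_sum_leq (w : 'S_n) S : low_sum #|S| <= \sum_(i in S) p (w i).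
Proof.
pose u := (w * tau^-1)%g.
have uE i : p (w i) = sorted_p (u i) by rewrite /sorted_p permM permKV.
under eq_bigr => i _ do rewrite uE.
rewrite -(big_imset sorted_p (in2W (@perm_inj _ u))) -(card_imset (mem S) (@perm_inj _ u)).
by apply: prefix_sum_leq => i j /sorted_p_mono/ltW.
Qed.

Lemma partitioned_permutohedron_hpoly K :
  partitioned_permutohedron p K = hpoly (constr_normal K) constr_bound.
Proof.
apply/seteqP; split=> x.
  move=> [xP xK] [[S|k]|].
  - apply: (conv_hull_dot _ xP) => w; rewrite dot_subset lerN2.
    by under eq_bigr => i _ do rewrite mxE; exact: low_sum_leq.
  - by rewrite dot_step; case: ifP => // kK; have [_] := xK k kK; rewrite subr_le0.
  - apply: (conv_hull_dot _ xP) => w; rewrite dot_total /= low_sum_full.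
    by under eq_bigr => i _ do rewrite mxE; rewrite [leRHS](reindex_inj (@perm_inj _ w)).
move=> /hpolyP[xT xS xK]; split=> [|k kK].
  by apply: permutohedron_hpoly; apply/hpolyP; split=> // k; rewrite inE.
by split; [rewrite /hyperplaneE /= xT low_sum_full|exact: xK].
Qed.

End HDescription.

(** * Linear systems prescribing prefix sums and differences *)

Section CutMatrix.
Variables (R : realType) (n : nat) (w : 'S_n) (D : {set 'I_n}).
Hypothesis lastD : forall j : 'I_n, j.+1 = n -> j \in D.
Implicit Types (v : 'rV[R]_n) (j : 'I_n) (k : 'I_n.-1).

(** Rows are letters and columns positions in the order [w]. By [lastD] the last column gives the
    total sum, and a difference column always has a next position. *)
Definition cut_mx : 'M[R]_n := \matrix_(a, j)
  if j \in D then ((w^-1)%g a <= j)%N%:R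
  else ((w^-1)%g a == j.+1 :> nat)%:R - ((w^-1)%g a == j)%:R.

Lemma mul_cut_mx v j : j \in D ->
  (v *m cut_mx) 0 j = prefix_sum (fun i => v 0 (w i)) j.+1.
Proof.
move=> jD; rewrite mxE (reindex_inj (@perm_inj _ w)) /= [RHS]big_mkcond.
apply: eq_bigr => i _; rewrite mxE permK jD ltnS.
by case: leqP => _; rewrite ?mulr1 ?mulr0.
Qed.

Lemma mul_cut_mx_step v k : lo k \notin D ->
  (v *m cut_mx) 0 (lo k) = v 0 (w (hi k)) - v 0 (w (lo k)).
Proof.
move=> /negPf kD; rewrite mxE (reindex_inj (@perm_inj _ w)) /=.
under eq_bigr => i _ do rewrite mxE permK kD mulrBr.
rewrite sumrB; congr (_ - _).
  rewrite (bigD1 (hi k)) //= eqxx mulr1 big1 ?addr0 // => i.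
  by rewrite -val_eqE /= => /negPf ->; rewrite mulr0.
rewrite (bigD1 (lo k)) //= eqxx mulr1 big1 ?addr0 // => i /negPf ->.
by rewrite mulr0.
Qed.

(* Abel summation: with s_j the prefix sums of y = v o w,
   sum_(i <= j) y_i^2 = y_j s_j - sum_(i < j) (y_(i+1) - y_i) s_i, and all the
   products on the right vanish. *)
Lemma cut_mx_unit : cut_mx \in unitmx.
Proof.
rewrite -row_free_unit; apply/inj_row_free => v v0.
pose y i := v 0 (w i).
have vD j : j \in D -> prefix_sum y j.+1 = 0.
  by move=> jD; rewrite -mul_cut_mx // v0 mxE.
have vk k : lo k \notin D -> y (hi k) = y (lo k).
  by move=> kD; apply/eqP; rewrite -subr_eq0 -mul_cut_mx_step // v0 mxE.
have abel j : \sum_(i < n | (i < j.+1)%N) y i ^+ 2 = y j * prefix_sum y j.+1.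
  have [m] := ubnP j; elim: m j => // m IH j jm.
  rewrite -[LHS]/(prefix_sum (fun i => y i ^+ 2) j.+1) !prefix_sumS.
  case: (posnP j) => [j0|jp]; first by rewrite j0 !prefix_sum0 !add0r.
  have j'n : (j.-1 < n)%N by have := ltn_ord j; lia.
  have [k k1 k2] : exists2 k, Ordinal j'n = lo k & j = hi k.
    by apply: lo_hiP; rewrite /= prednK.
  have -> : val j = (lo k).+1 by rewrite k2.
  rewrite [prefix_sum (fun i => y i ^+ 2) _]IH; last by rewrite -k1 /=; lia.
  rewrite k2 mulrDr; congr (_ + _).
  case: (boolP (lo k \in D)) => kD; first by rewrite vD // !mulr0.
  by rewrite vk.
have y0 i : y i = 0.
  have n0 : (0 < n)%N := leq_ltn_trans (leq0n _) (ltn_ord i).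
  have nn : (n.-1 < n)%N by lia.
  have lD : Ordinal nn \in D by apply: lastD; rewrite /= prednK.
  have := abel (Ordinal nn); rewrite vD // mulr0 => s0.
  have := psumr_eq0P (fun i _ => sqr_ge0 (y i)) s0.
  move=> /(_ i); rewrite /= prednK // ltn_ord => /(_ isT) /eqP.
  by rewrite sqrf_eq0 => /eqP.
by apply/rowP => a; rewrite mxE -(permKV w a); apply: y0.
Qed.

Lemma cut_mx_solve (c : 'I_n -> R) (d : 'I_n.-1 -> R) : exists v,
  (forall j, j \in D -> prefix_sum (fun i => v 0 (w i)) j.+1 = c j) /\
  (forall k, lo k \notin D -> v 0 (w (hi k)) - v 0 (w (lo k)) = d k).
Proof.
(* For [j] outside [D] the sum has one term; it only translates a position into the gap that follows
   it. *)
pose b : 'rV[R]_n := \row_j if j \in D then c j else \sum_(k | lo k == j) d k.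
exists (b *m invmx cut_mx).
have bE : b *m invmx cut_mx *m cut_mx = b by rewrite mulmxKV ?cut_mx_unit.
split=> [j jD|k kD]; first by rewrite -mul_cut_mx // bE mxE jD.
rewrite -mul_cut_mx_step // bE mxE (negPf kD) (big_pred1 k) //.
Qed.

(** The columns in [Z] of an invertible matrix define a surjection, and rank-nullity gives the
    dimension. *)
Lemma cut_mx_kernel (Z : {set 'I_n}) : exists2 V : {vspace 'rV[R]_n},
  \dim V = (n - #|Z|)%N &
  forall v, (v \in V) <-> forall j, j \in Z -> (v *m cut_mx) 0 j = 0.
Proof.
pose B := colsub (@enum_val _ (mem Z)) cut_mx.
pose f := linfun (mulmxr B : 'rV[R]_n -> 'rV[R]_#|Z|).
have fE v (z : 'I_#|Z|) : f v 0 z = (v *m cut_mx) 0 (enum_val z).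
  by rewrite lfunE /= !mxE; apply: eq_bigr => i _; rewrite mxE.
exists (lker f).
  have := limg_ker_dim f fullv; rewrite capfv dimvf /= /dim /= mul1n.
  have -> : limg f = fullv.
    apply/eqP; rewrite eqEsubv subvf; apply/subvP => c _; apply/memv_imgP.
    pose c' : 'rV[R]_n := \row_j \sum_(z | enum_val z == j) c 0 z.
    exists (c' *m invmx cut_mx); first exact: memvf.
    apply/rowP => k; rewrite fE mulmxKV ?cut_mx_unit // mxE.
    by rewrite (big_pred1 k) // => k'; rewrite (inj_eq enum_val_inj).
  by rewrite dimvf /dim /= mul1n => /(canRL (addnK _)).
move=> v; rewrite memv_ker; split=> [/eqP fv j jZ|vZ].
  by rewrite -(enum_rankK_in jZ jZ) -fE fv mxE.
by apply/eqP/rowP => k; rewrite fE vZ ?enum_valP // mxE.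
Qed.

End CutMatrix.

(** * Codes of faces *)

Lemma monotone_step (R : realType) n (y : 'I_n -> R) :
  (forall k : 'I_n.-1, y (lo k) <= y (hi k)) ->
  forall i j : 'I_n, (i <= j)%N -> y i <= y j.
Proof.
move=> yk i j; have [m] := ubnP j; elim: m j => // m IH j jm.
rewrite leq_eqVlt val_eqE => /predU1P[-> //|ij].
have jp : (j.-1 < n)%N by have := ltn_ord j; lia.
have [k k1 k2] : exists2 k, Ordinal jp = lo k & j = hi k.
  by apply: lo_hiP; rewrite /= prednK // (leq_ltn_trans _ ij).
rewrite k2; apply: le_trans (yk k); apply: IH; rewrite -k1 /=; lia.
Qed.

Section FaceCodes.
Variables (R : realType) (n : nat) (p : 'I_n -> R) (tau : 'S_n).
Hypothesis n_gt0 : (0 < n)%N.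
Hypothesis tauP : sorts p tau.
Variable K : {set 'I_n.-1}.
Implicit Types (w : 'S_n) (S : {set 'I_n}) (x z v : 'rV[R]_n) (k i : 'I_n.-1).

Local Notation phi := (low_sum p tau).
Local Notation constr_bound := (constr_bound p tau).
Local Notation sorted_p := (sorted_p p tau).
Local Notation normal := (constr_normal R K).
Local Notation P := (hpoly normal constr_bound).
Local Notation tight := (tight normal constr_bound).

Definition prefix_set w k : {set 'I_n} := [set a | ((w^-1)%g a < k.+1)%N].

Lemma mem_prefix w k (j : 'I_n) : (w j \in prefix_set w k) = (j <= k)%N.
Proof. by rewrite inE permK ltnS. Qed.

Lemma card_prefix_set w k : #|prefix_set w k| = k.+1.
Proof. by rewrite card_prefix //; have := ltn_ord (hi k); apply: ltnW. Qed.

Lemma prefix_neq0 w k : (prefix_set w k == set0) = false.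
Proof. by rewrite -cards_eq0 card_prefix_set. Qed.

Lemma prefix_neqT w k : (prefix_set w k == setT) = false.
Proof.
apply/negP => /eqP/(congr1 (fun S : {set 'I_n} => #|S|)).
by rewrite card_prefix_set cardsT card_ord => kn; have := ltn_ord (hi k); rewrite /= kn ltnn.
Qed.

Lemma prefix_inj w : injective (prefix_set w).
Proof.
move=> k i /(congr1 (fun S : {set 'I_n} => #|S|)); rewrite !card_prefix_set => -[].
exact: val_inj.
Qed.

Lemma sum_prefix_set w k v :
  \sum_(a in prefix_set w k) v 0 a = prefix_sum (fun i : 'I_n => v 0 (w i)) k.+1.
Proof. by rewrite -(sum_prefix w (fun a => v 0 a)) //; have := ltn_ord (hi k); apply: ltnW. Qed.

(* A face is encoded by a permutation w listing its ordered set partition, each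
   block in increasing order, and by the status of each gap between w(k) and
   w(k+1): Some true for a bar between two blocks, Some false for an equality
   of the two coordinates, None for a free gap. *)
Definition face_code := ('S_n * {ffun 'I_n.-1 -> option bool})%type.

Definition gap_allowed w k (o : option bool) : bool :=
  match o with
  | Some true => true
  | Some false => adjacent_in K w k
  | None => k \notin Des w
  end.

Definition face_codes : {set face_code} :=
  [set c : face_code | (c.1 \in W_min K) && [forall k, gap_allowed c.1 k (c.2 k)]].

(** The constraints tight in the relative interior of the coded face. The empty set, the full set,
    the total and the void steps are tight at every point. *)
Definition code_tight (c : face_code) : {set constraint n} :=
  [set t | match t with
    | None => true
    | Some (inl B) => [|| B == set0, B == setT |
        [exists k, (c.2 k == Some true) && (B == prefix_set c.1 k)]]
    | Some (inr k) => (k \notin K) ||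
        [exists i, [&& c.2 i == Some false, c.1 (lo i) == lo k & c.1 (hi i) == hi k]]
    end].

Definition code_dim (c : face_code) : nat := #|[set k | c.2 k == None]|.

Lemma sum_perm w v : \sum_a v 0 a = prefix_sum (fun i : 'I_n => v 0 (w i)) n.
Proof. by rewrite prefix_sum_full (reindex_inj (@perm_inj _ w)). Qed.

Lemma code_kernel c : c \in face_codes ->
  exists2 V : {vspace 'rV[R]_n}, \dim V = code_dim c &
    forall v, (v \in V) <-> forall t, t \in code_tight c -> dot (normal t) v = 0.
Proof.
case: c => w s; rewrite inE /= => /andP[wK /forallP sP].
(* Only glued gaps become difference columns. [Z] below omits the free gaps: their prefix sums
   complete the invertible system but stay unconstrained, and they account for the dimension. *)
pose D := ~: [set lo k | k in [set k | s k == Some false]].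
have loD k : (lo k \in D) = (s k != Some false).
  by rewrite inE mem_imset ?inE //; exact: lo_inj.
have lastD (j : 'I_n) : j.+1 = n -> j \in D.
  move=> jn; rewrite inE; apply/imsetP => -[k _ jk].
  by have := ltn_ord (hi k); rewrite /= -(val_lo k) -jk jn ltnn.
pose Z := ~: [set lo k | k in [set k | s k == None]].
have loZ k : (lo k \in Z) = (s k != None).
  by rewrite inE mem_imset ?inE //; exact: lo_inj.
have lastZ (j : 'I_n) : j.+1 = n -> j \in Z.
  move=> jn; rewrite inE; apply/imsetP => -[k _ jk].
  by have := ltn_ord (hi k); rewrite /= -(val_lo k) -jk jn ltnn.
have [V Vdim VE] := @cut_mx_kernel R n w D lastD Z.
exists V.
  have cardlo : #|[set lo k | k in [set k | s k == None]]| = code_dim (w, s).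
    by rewrite card_imset //; exact: lo_inj.
  rewrite Vdim /Z cardsCs setCK card_ord cardlo subKn //.
  by apply: leq_trans (max_card _) _; rewrite card_ord leq_pred.
move=> v; split=> [/VE vZ|vT].
  have total : \sum_a v 0 a = 0.
    have nn : (n.-1 < n)%N by lia.
    have jn : (Ordinal nn).+1 = n by rewrite /= prednK.
    by have := vZ _ (lastZ _ jn); rewrite mul_cut_mx ?lastD // jn -sum_perm.
  move=> [[B|k]|]; rewrite inE.
  - rewrite dot_subset => /or3P[/eqP->|/eqP->|/existsP[k /andP[/eqP sk /eqP->]]].
    + by rewrite big_set0 oppr0.
    + by rewrite sum_setT total oppr0.
    + by rewrite sum_prefix_set -(@mul_cut_mx _ _ w D v (lo k)) ?vZ ?oppr0 ?loZ ?loD ?sk.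
  - rewrite dot_step; case: ifP => //= _ /existsP[i /and3P[/eqP si /eqP <- /eqP <-]].
    apply/eqP; rewrite subr_eq0 eq_sym -subr_eq0 -(@mul_cut_mx_step _ _ w D) ?loD ?si //.
    by rewrite vZ // loZ si.
  - by rewrite dot_total.
apply/VE => j jZ.
case: (ord_lastVlo j) => [jn|[k jk]].
  rewrite mul_cut_mx ?lastD // jn -sum_perm -(dot_total K).
  by apply: vT; rewrite inE.
rewrite jk loZ in jZ *; case sk: (s k) jZ => [[]|] // _.
  rewrite mul_cut_mx ?loD ?sk // -(sum_prefix_set w k v); apply/eqP.
  rewrite -oppr_eq0 -(dot_subset K); apply/eqP/vT; rewrite inE.
  by apply/or3P/Or33/existsP; exists k; rewrite sk !eqxx.
have := sP k; rewrite /= sk => /exists_inP[k' k'K /andP[/eqP wl /eqP wh]].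
rewrite mul_cut_mx_step ?loD ?sk // wl wh; apply/eqP; rewrite subr_eq0 eq_sym -subr_eq0.
have := vT (Some (inr k')); rewrite dot_step k'K inE => -> //.
by rewrite k'K; apply/existsP; exists k; rewrite sk wl wh !eqxx.
Qed.

(** * A point with prescribed tight constraints *)

Section CodePoint.
Variables (w : 'S_n) (s : {ffun 'I_n.-1 -> option bool}) (z : 'rV[R]_n).
Let y (i : 'I_n) := z 0 (w i).
Let r m := prefix_sum y m - phi m.
Hypothesis rn : r n = 0.
Hypothesis r_cut : forall k, s k = Some true -> r k.+1 = 0.
Hypothesis y_glued : forall k, s k = Some false -> y (hi k) = y (lo k).
(** Any factor strictly between 0 and 1 would serve as well as 1/2: positivity makes [y] increase
    across a free gap, and being below 1 makes the slack [r] strictly concave there. *)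
Hypothesis y_free : forall k, s k = None ->
  y (hi k) - y (lo k) = (sorted_p (hi k) - sorted_p (lo k)) / 2.

Let gap_gt0 k : 0 < sorted_p (hi k) - sorted_p (lo k).
Proof. by rewrite subr_gt0; apply: sorted_p_mono. Qed.

Let r_diff2 k : r k.+2 + r k - 2 * r k.+1 =
  (y (hi k) - y (lo k)) - (sorted_p (hi k) - sorted_p (lo k)).
Proof.
have := prefix_sumS y (hi k); have := prefix_sumS y (lo k).
by have := low_sumS p tau (hi k); have := low_sumS p tau (lo k); rewrite /r /=; lra.
Qed.

Let r_concave k : s k != Some true -> r k.+2 + r k < 2 * r k.+1.
Proof.
have := gap_gt0 k; have := r_diff2 k; case sk: (s k) => [[]|] // E g _.
  by have := y_glued sk; lra.
by have := y_free sk; lra.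
Qed.

(* A sequence vanishing at the cuts and strictly concave elsewhere attains its
   minimum at a cut. *)
Let r_ge0 m : (m <= n)%N -> 0 <= r m.
Proof.
move=> mn; have [m0 _ m0min] := @arg_minP _ R _ (ord0 : 'I_n.+1) xpredT (fun j => r j) isT.
have rmin j : (j <= n)%N -> r m0 <= r j.
  by move=> jn; apply: (m0min (Ordinal (jn : (j < n.+1)%N)) isT).
apply: le_trans (rmin _ mn); rewrite leNgt; apply/negP => r_lt0.
have m_gt0 : (0 < m0)%N.
  by rewrite lt0n; apply/eqP => m00; move: r_lt0; rewrite m00 /r /low_sum !prefix_sum0 subrr ltxx.
have m_ltn : (m0 < n)%N.
  rewrite ltn_neqAle -ltnS ltn_ord andbT; apply/eqP => m0n.
  by move: r_lt0; rewrite m0n rn ltxx.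
have kn : (m0.-1 < n.-1)%N by lia.
pose k := Ordinal kn; have m0E : m0 = k.+1 :> nat by rewrite /= prednK.
case: (eqVneq (s k) (Some true)) => [/r_cut|/r_concave].
  by rewrite -m0E => r0; rewrite r0 ltxx in r_lt0.
have := rmin k.+2; have := rmin k; rewrite -m0E /= => H1 H2.
by have := H1 ltac:(lia); have := H2 ltac:(lia); lra.
Qed.

Let r_gt0 k : s k != Some true -> 0 < r k.+1.
Proof.
move=> /r_concave; have kn := ltn_ord (hi k); rewrite /= in kn.
have := @r_ge0 k ltac:(lia); have := @r_ge0 k.+2 ltac:(lia); lra.
Qed.

(** At a bar [r] vanishes while its neighbours are nonnegative, so by [r_diff2] the gap of [y] is at
    least that of [sorted_p]. *)
Let y_step k : s k != Some false -> y (lo k) < y (hi k).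
Proof.
have := gap_gt0 k; have := r_diff2 k; have kn := ltn_ord (hi k); rewrite /= in kn.
have := @r_ge0 k ltac:(lia); have := @r_ge0 k.+2 ltac:(lia).
case sk: (s k) => [[]|] // r2 r0 E g _; first by have := r_cut sk; lra.
by have := y_free sk; lra.
Qed.

Let y_mono (i j : 'I_n) : (i <= j)%N -> y i <= y j.
Proof.
move: i j; apply: monotone_step => k.
by case: (eqVneq (s k) (Some false)) => [/y_glued ->|/y_step/ltW].
Qed.

Lemma code_point : (w, s) \in face_codes -> P z /\ tight z = code_tight (w, s).
Proof.
rewrite inE /= => /andP[wK /forallP sP].
have zT : \sum_a z 0 a = phi n by rewrite (sum_perm w); apply/eqP; rewrite -subr_eq0; apply/eqP.
have yS S : prefix_sum y #|S| <= \sum_(a in S) z 0 a.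
  have -> : \sum_(a in S) z 0 a = \sum_(i in w @^-1: S) y i.
    by rewrite (reindex_inj (@perm_inj _ w)); apply: eq_bigl => i; rewrite inE.
  have -> : #|S| = #|w @^-1: S| by rewrite card_preimset //; exact: perm_inj.
  by apply: prefix_sum_leq => i j /ltnW; apply: y_mono.
have Sn S : (#|S| <= n)%N by rewrite -[leqRHS]card_ord max_card.
have zS S : phi #|S| <= \sum_(a in S) z 0 a.
  by apply: le_trans (yS S); rewrite -subr_ge0; apply: r_ge0.
have wKP := wK; rewrite W_minE in wKP.
have pos k : k \in K -> ((w^-1)%g (lo k) < (w^-1)%g (hi k))%N by move/forall_inP: wKP; apply.
have zK k : k \in K -> z 0 (lo k) <= z 0 (hi k).
  by move=> /pos /ltnW /y_mono; rewrite /y !permKV.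
split; first by apply/hpolyP.
apply/setP => -[[B|k]|]; last first.
- by rewrite tight_None zT inE eqxx.
- rewrite tight_inr inE /=; case kK: (k \in K) => //=.
  apply/eqP/existsP => [zk|[i /and3P[/eqP/y_glued E /eqP lE /eqP hE]]]; last first.
    by move: E; rewrite /y lE hE.
  (* [y] is constant from [i] to [j], so the gap after [i] is glued; validity of the code then makes
     the next letter [hi k]. *)
  set i := (w^-1)%g (lo k); set j := (w^-1)%g (hi k).
  have ij : (i < j)%N by apply: pos.
  have i1 : (i.+1 < n)%N by apply: leq_ltn_trans (ltn_ord j).
  have [k' ik' hk'] := lo_hiP (erefl : Ordinal i1 = i.+1 :> nat).
  have sk' : s k' = Some false.
    apply/eqP; apply: contraT => /y_step; rewrite -ik' -hk' ltNge.
    have : y (Ordinal i1) <= y j by apply: y_mono.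
    by rewrite /y !permKV -zk => ->.
  exists k'; rewrite sk' -ik' permKV !eqxx /=.
  have := sP k'; rewrite /= sk' => /exists_inP[k'' _ /andP[/eqP wl /eqP ->]].
  by move: wl; rewrite -ik' permKV => /lo_inj ->.
rewrite tight_inl inE /=; apply/eqP/or3P => [zB|].
  have phB : r #|B| = 0.
    by apply/eqP; rewrite eq_le r_ge0 ?Sn // andbT subr_le0 -zB yS.
  case: (posnP #|B|) => [/eqP|B0]; first by rewrite cards_eq0; constructor 1.
  move: (Sn B); rewrite leq_eqVlt => /predU1P[Bn|Bn].
    by constructor 2; rewrite eqEcard subsetT cardsT card_ord Bn /=.
  constructor 3; have kn : (#|B|.-1 < n.-1)%N by lia.
  pose k := Ordinal kn; have kB : #|B| = k.+1 by rewrite /= prednK.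
  have sk : s k = Some true.
    by apply/eqP; apply: contraT => /r_gt0; rewrite -kB phB ltxx.
  apply/existsP; exists k; rewrite sk eqxx /=.
  (* [B] and the prefix of the same size are both tight, hence comparable, hence equal. *)
  have tp : \sum_(a in prefix_set w k) z 0 a = phi #|prefix_set w k|.
    by rewrite sum_prefix_set card_prefix_set; apply/eqP; rewrite -subr_eq0; apply/eqP/r_cut.
  have [sub|sub] := tight_subset_chain tauP zS zB tp.
    by rewrite eqEcard sub card_prefix_set kB /=.
  by rewrite eq_sym eqEcard sub card_prefix_set kB /=.
case=> [/eqP->|/eqP->|/existsP[k /andP[/eqP sk /eqP->]]].
- by rewrite big_set0 cards0 /low_sum prefix_sum0.
- by rewrite sum_setT cardsT card_ord.
by rewrite sum_prefix_set card_prefix_set; apply/eqP; rewrite -subr_eq0; apply/eqP/r_cut.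
Qed.

End CodePoint.

Lemma code_realizable c : c \in face_codes -> exists2 z, P z & tight z = code_tight c.
Proof.
case: c => w s cP.
(* Unlike in [code_kernel], free gaps prescribe differences here, so only the bars and the last
   position prescribe prefix sums. *)
pose D := [set j : 'I_n | (j.+1 == n) || [exists k, (lo k == j) && (s k == Some true)]].
have lastD (j : 'I_n) : j.+1 = n -> j \in D by rewrite inE => ->; rewrite eqxx.
have loD k : (lo k \in D) = (s k == Some true).
  rewrite inE /=; have := ltn_ord (hi k); rewrite /= => kn; rewrite ltn_eqF //=.
  apply/existsP/idP => [[i /andP[/eqP/lo_inj ->]] //|sk].
  by exists k; rewrite eqxx.
have [z [zD zk]] := @cut_mx_solve R n w D lastD (fun j => phi j.+1)
  (fun k => if s k == Some false then 0 else (sorted_p (hi k) - sorted_p (lo k)) / 2).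
have [] := @code_point w s z _ _ _ _ cP; last by exists z.
- have nn : (n.-1 < n)%N by lia.
  have jn : (Ordinal nn).+1 = n by rewrite /= prednK.
  by have := zD _ (lastD _ jn); rewrite jn => ->; rewrite subrr.
- by move=> k sk; rewrite -(val_lo k) zD ?subrr // loD sk.
- move=> k sk; apply/eqP; rewrite -subr_eq0 zk; first by rewrite sk.
  by rewrite loD sk.
by move=> k sk; rewrite zk; [rewrite sk|rewrite loD sk].
Qed.

Implicit Types (T : {set constraint n}) (a b : 'I_n).

Definition sets_avoiding T a : {set {set 'I_n}} :=
  [set S | (Some (inl S) \in T) && (a \notin S)].

(** The tight subsets form a chain, so this ranks the blocks of the ordered set partition: letters
    of earlier blocks are avoided by fewer tight sets. *)
Definition height T a : nat := #|sets_avoiding T a|.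

Lemma in_sets_avoiding T a S :
  (S \in sets_avoiding T a) = (Some (inl S) \in T) && (a \notin S).
Proof. by rewrite in_set. Qed.

Definition code_key T a : nat := (height T a * n + a)%N.

Lemma code_key_inj T : injective (code_key T).
Proof.
move=> a b /(congr1 (modn^~ n)); rewrite /code_key !modnMDl !modn_small //.
exact: val_inj.
Qed.

Lemma code_key_lt T a b :
  (code_key T a < code_key T b)%O =
  (height T a < height T b)%N || ((height T a == height T b) && (a < b)%N).
Proof.
rewrite ltEnat /= /code_key; have := ltn_ord a; have := ltn_ord b.
case: (ltngtP (height T a) (height T b)) => [h|h|->] /= bn an; last by rewrite ltn_add2l.
  by apply/idP; nia.
by apply/negbTE; rewrite -leqNgt; nia.
Qed.

Lemma adjacent_in_ltn w k : adjacent_in K w k -> (w (lo k) < w (hi k))%N.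
Proof. by move=> /exists_inP[i _ /andP[/eqP -> /eqP ->]] /=. Qed.

Lemma inl_code_tight c S : (Some (inl S) \in code_tight c) =
  [|| S == set0, S == setT |
    [exists k, (c.2 k == Some true) && (S == prefix_set c.1 k)]].
Proof. by rewrite inE. Qed.

(** This recovers the permutation from the tight set: along [w] the height never drops, it jumps at
    each bar, and the remaining gaps are ascents. *)
Lemma code_tight_sorts c : c \in face_codes -> sorts (code_key (code_tight c)) c.1.
Proof.
case: c => w s; rewrite inE /= => /andP[_ /forallP sP]; apply: sorts_step => k.
have sub : sets_avoiding (code_tight (w, s)) (w (lo k))
    \subset sets_avoiding (code_tight (w, s)) (w (hi k)).
  apply/subsetP => S; rewrite !in_sets_avoiding => /andP[ST]; rewrite ST.
  move: ST; rewrite inl_code_tight => /or3P[/eqP->|/eqP->|/existsP[i /andP[_ /eqP->]]].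
  - by rewrite !inE.
  - by rewrite !inE.
  by rewrite !mem_prefix /= -!ltnNge => /ltnW.
rewrite code_key_lt; move: (subset_leq_card sub); rewrite leq_eqVlt.
case/orP => [h|->//]; rewrite /height h /=; apply/orP; right.
have := sP k; case sk: (s k) => [[]|] /=; last first.
- rewrite inE -leqNgt leq_eqVlt => /predU1P[/val_inj/perm_inj/(congr1 val) /=|//].
  lia.
- exact: adjacent_in_ltn.
move=> _; exfalso; move: (subset_cardP (eqP h)) => /(_ sub) /(_ (prefix_set w k)).
rewrite !in_sets_avoiding !mem_prefix /= leqnn ltnn !andbF !andbT.
move/esym/negbT/negP; apply; rewrite inl_code_tight; apply/or3P/Or33/existsP.
by exists k; rewrite sk !eqxx.
Qed.

(** Once [w] is known, bars are read off from the tight prefixes and equalities from the tight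
    steps, each letter having one position. *)
Lemma code_tight_inj : {in face_codes &, injective code_tight}.
Proof.
move=> [w s] [w' s'] cP c'P E.
have wE : w = w'.
  apply: sorts_unique (code_tight_sorts cP) _; rewrite E.
  exact: (code_tight_sorts c'P).
rewrite -{w'}wE in c'P E *; congr (_, _); apply/ffunP => k.
have cut u : (Some (inl (prefix_set w k)) \in code_tight (w, u)) = (u k == Some true).
  rewrite inl_code_tight prefix_neq0 prefix_neqT /=; apply/existsP/idP => [[i]|uk].
    by move=> /andP[ui /eqP/prefix_inj ->].
  by exists k; rewrite uk eqxx.
have glued u u' : (w, u) \in face_codes -> code_tight (w, u) = code_tight (w, u') ->
    u k = Some false -> u' k = Some false.
  rewrite inE /= => /andP[_ /forallP/(_ k)] + uE uk; rewrite uk /=.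
  move=> /exists_inP[i iK /andP[wl wh]].
  have : Some (inr i) \in code_tight (w, u).
    by rewrite inE iK; apply/existsP; exists k; rewrite uk wl wh eqxx.
  rewrite uE inE iK => /existsP[j /and3P[/eqP <- /eqP wj _]].
  by congr (u' _); apply/lo_inj/(@perm_inj _ w); rewrite wj (eqP wl).
have := cut s'; rewrite -E cut; have := glued s s' cP E; have := glued s' s c'P (esym E).
by case: (s k) => [[]|]; case: (s' k) => [[]|] //= g1 g2; rewrite ?g1 ?g2 // => /esym/eqP.
Qed.

(** * The code of a given point *)

Section CodeOfPoint.
Variable z : 'rV[R]_n.
Hypothesis Pz : P z.

Let T := tight z.

Let zS S : phi #|S| <= \sum_(a in S) z 0 a.
Proof. by have [] := (hpolyP p tau K z).1 Pz. Qed.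

Let zT : \sum_a z 0 a = phi n.
Proof. by have [] := (hpolyP p tau K z).1 Pz. Qed.

Let tight_lt S a b : Some (inl S) \in T -> a \in S -> b \notin S -> z 0 a < z 0 b.
Proof. by rewrite tight_inl => /eqP; apply: tight_subset_lt. Qed.

(** If [S] contained [b] but not [a], then z_b < z_a, every tight set avoiding [b] would avoid [a],
    and [S] itself would make the height of [a] strictly larger. *)
Let height_le a b S : (height T a <= height T b)%N -> Some (inl S) \in T ->
  b \in S -> a \in S.
Proof.
move=> hab ST bS; apply: contraT => aS.
suff : (height T b < height T a)%N by rewrite ltnNge hab.
apply: proper_card; apply/properP; split; last by exists S; rewrite in_sets_avoiding ST ?bS.
apply/subsetP => U; rewrite !in_sets_avoiding => /andP[UT bU]; rewrite UT /=.
apply: contra bU => aU; apply: contraT => bU.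
by have := lt_trans (tight_lt UT aU bU) (tight_lt ST bS aS); rewrite ltxx.
Qed.

Let height_leP a b : (forall S, Some (inl S) \in T -> b \in S -> a \in S) ->
  (height T a <= height T b)%N.
Proof.
move=> H; apply: subset_leq_card; apply/subsetP => S.
rewrite !in_sets_avoiding => /andP[ST aS]; rewrite ST /=.
by apply: contra aS; apply: H.
Qed.

Variable w : 'S_n.
Hypothesis wT : sorts (code_key T) w.

Let height_w (i j : 'I_n) : (i <= j)%N -> (height T (w i) <= height T (w j))%N.
Proof.
rewrite leq_eqVlt => /predU1P[/val_inj -> //|/wT]; rewrite code_key_lt.
by case/orP => [/ltnW //|/andP[/eqP ->]].
Qed.

Let prefix_of_tight S k : Some (inl S) \in T -> w (lo k) \in S -> w (hi k) \notin S ->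
  S = prefix_set w k.
Proof.
move=> ST loS hiS; apply/setP => a; rewrite -(permKV w a) mem_prefix.
set j := (w^-1)%g a; apply/idP/idP => [jS|jk].
  rewrite leqNgt; apply: contra hiS => kj.
  by apply: (height_le (@height_w (hi k) j kj)).
exact: (height_le (@height_w j (lo k) jk)).
Qed.

Definition code_of_point : {ffun 'I_n.-1 -> option bool} :=
  [ffun k => if Some (inl (prefix_set w k)) \in T then Some true
     else if (z 0 (w (lo k)) == z 0 (w (hi k))) && adjacent_in K w k then Some false
     else None].

Lemma code_of_point_valid : (w, code_of_point) \in face_codes.
Proof.
rewrite inE /=; apply/andP; split.
  rewrite W_minE; apply/forall_inP => k kK; rewrite -(sorts_lt _ _ wT) !permKV code_key_lt.
  rewrite /= ltnSn andbT orbC -leq_eqVlt; apply: height_leP => S ST hS.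
  apply: contraT => lS; have := tight_lt ST hS lS.
  by have [_ _ zK] := (hpolyP p tau K z).1 Pz; rewrite ltNge zK.
apply/forallP => k; rewrite ffunE; case: ifP => // kT; case: ifP => [/andP[] //|_] /=.
apply/negP; rewrite inE => desc.
have : (height T (w (lo k)) < height T (w (hi k)))%N.
  have := wT (ltnSn k : (lo k < hi k)%N); rewrite code_key_lt => /orP[//|/andP[_]].
  by rewrite ltnNge (ltnW desc).
rewrite ltnNge => /negP; apply; apply: height_leP => S ST lS.
by apply: contraT => hS; rewrite -(prefix_of_tight ST lS hS) ST in kT.
Qed.

Lemma code_of_point_tight : T = code_tight (w, code_of_point).
Proof.
apply/setP => -[[S|k]|]; last by rewrite tight_None zT !inE eqxx.
  rewrite inl_code_tight /=; apply/idP/or3P => [ST|]; last first.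
    case=> [/eqP->|/eqP->|/existsP[k /andP[+ /eqP->]]].
    - by rewrite tight_inl big_set0 cards0 /low_sum prefix_sum0.
    - by rewrite tight_inl sum_setT zT cardsT card_ord.
    by rewrite ffunE; case: ifP => // _; case: ifP.
  case: (eqVneq S set0) => [|/set0Pn[a aS]]; first by constructor 1.
  have aS' : w ((w^-1)%g a) \in S by rewrite permKV.
  (* [i] is the last position occupied by [S]; as tight sets are closed downwards in height, [S]
     consists of everything up to it. *)
  have [i iS imax] := @arg_maxnP _ ((w^-1)%g a) (fun i : 'I_n => w i \in S)
    (fun i : 'I_n => i : nat) aS'.
  case: (ord_lastVlo i) => [iN|[k ik]].
    constructor 2; apply/eqP/setP => b; rewrite inE -(permKV w b).
    by apply: (height_le (@height_w _ i _)) => //; rewrite -ltnS iN ltn_ord.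
  constructor 3; apply/existsP; exists k; rewrite ik in iS imax.
  have hS : w (hi k) \notin S by apply/negP => /imax /=; rewrite ltnn.
  by rewrite ffunE -(prefix_of_tight ST iS hS) ST !eqxx.
rewrite tight_inr inE /=; case kK: (k \in K) => //=.
apply/eqP/existsP => [zk|[i]]; last first.
  rewrite ffunE; case: ifP => // _; case: ifP => // /andP[/eqP zw _].
  by move=> /andP[_ /andP[/eqP <- /eqP <-]].
have hE : height T (lo k) = height T (hi k).
  apply/eqP; rewrite eqn_leq; apply/andP; split; apply: height_leP => S ST aS;
    apply: contraT => bS; have := tight_lt ST aS bS; by rewrite zk ltxx.
set i := (w^-1)%g (lo k); set j := (w^-1)%g (hi k).
have ij : (i < j)%N.
  by rewrite -(sorts_lt _ _ wT) !permKV code_key_lt hE eqxx ltnSn orbT.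
have i1 : (i.+1 < n)%N by apply: leq_ltn_trans (ltn_ord j).
have [k' ik' hk'] := lo_hiP (erefl : Ordinal i1 = i.+1 :> nat).
(* Having equal heights, [lo k] and [hi k] have consecutive integers as keys, which leaves no room
   for a letter between them. *)
have jE : j = hi k'.
  rewrite -hk'; apply/val_inj/eqP; rewrite eqn_leq ij andbT leqNgt; apply/negP => i1j.
  have h1 := wT (ltnSn i : (i < Ordinal i1)%N); have h2 := wT (i1j : (Ordinal i1 < j)%N).
  rewrite !permKV /code_key in h1 h2; move: h1 h2; rewrite !ltEnat /= hE; lia.
have wl : w (lo k') = lo k by rewrite -ik' permKV.
have wh : w (hi k') = hi k by rewrite -jE permKV.
exists k'; rewrite wl wh !eqxx !andbT ffunE wl wh zk eqxx /=.
have -> : adjacent_in K w k' by apply/exists_inP; exists k => //; rewrite wl wh !eqxx.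
case: ifP => // kT; have := tight_lt kT (a := lo k) (b := hi k).
by rewrite -wl -wh !mem_prefix /= leqnn ltnn wl wh zk ltxx => /(_ isT isT).
Qed.

End CodeOfPoint.

Lemma code_of_face z : P z -> exists2 c, c \in face_codes & tight z = code_tight c.
Proof.
move=> Pz; have [w wT] := sorts_exists (@code_key_inj (tight z)).
exists (w, code_of_point z w); first exact: code_of_point_valid.
exact: code_of_point_tight.
Qed.

Lemma f_number_partitioned_permutohedron d :
  f_number (partitioned_permutohedron p K) d = #|[set c in face_codes | code_dim c == d]|.
Proof.
rewrite (partitioned_permutohedron_hpoly tauP); apply: f_number_hpoly.
- exact: code_tight_inj.
- exact: code_of_face.
- exact: code_realizable.
- exact: code_kernel.
Qed.

(** Each free gap adds one dimension, hence [t - 1]. A descent has only its bar, an ascent a bar or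
    a free gap, and a K-adjacency also an equality. *)
Lemma sum_gap_allowed (A : comNzRingType) (t : A) w k :
  \sum_(o | gap_allowed w k o) (if o == None then t - 1 else 1) = step_weight K t w k.
Proof.
rewrite big_mkcond (bigD1 None) //= (bigD1 (Some true)) //= (bigD1 (Some false)) //=.
rewrite big1 ?addr0 => [|[[]|]] //; rewrite inE -leqNgt /step_weight.
have := @adjacent_in_ltn w k; case: (adjacent_in K w k) => [/(_ isT)|_].
  by move=> lt; rewrite (ltnW lt) ltnNge (ltnW lt) /=; ring.
case: (leqP (w (lo k)) (w (hi k))) => _; first by ring.
by rewrite add0r addr0.
Qed.

(** For fixed [w] the statuses of the gaps are chosen independently, so the sum over codes factors
    into a product over gaps. *)
Lemma h_poly_partitioned_permutohedron :
  h_poly (partitioned_permutohedron p K) =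
  \sum_(w in W_min K) \prod_k step_weight K ('X : {poly int}) w k.
Proof.
transitivity (\sum_(c in face_codes) ('X - 1 : {poly int}) ^+ code_dim c).
  have dim_lt (c : face_code) : (code_dim c < n)%N.
    by apply: leq_ltn_trans (max_card _) _; rewrite card_ord ltn_predL.
  rewrite (partition_big (fun c => Ordinal (dim_lt c)) xpredT) //=.
  apply: eq_bigr => i _; rewrite f_number_partitioned_permutohedron.
  rewrite (eq_bigr (fun=> ('X - 1) ^+ i)); last by move=> c /andP[_ /eqP <-].
  rewrite (eq_bigl (mem [set c in face_codes | code_dim c == i])); last first.
    by move=> c; rewrite [RHS]inE -val_eqE.
  by rewrite sumr_const -natz scaler_nat.
rewrite (eq_bigl (fun c : face_code => (c.1 \in W_min K) && [forall k, gap_allowed c.1 k (c.2 k)])).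
  rewrite -(pair_big_dep (fun w => w \in W_min K)
    (fun w (s : {ffun 'I_n.-1 -> option bool}) => [forall k, gap_allowed w k (s k)])
    (fun w s => ('X - 1 : {poly int}) ^+ code_dim (w, s))).
  apply: eq_bigr => w _; under [RHS]eq_bigr => k _ do rewrite -sum_gap_allowed.
  rewrite bigA_distr_big_dep; apply: eq_big => [s|s _].
    by apply/forallP/familyP.
  rewrite -big_mkcond prodr_const; congr (_ ^+ _).
  by apply: eq_card => k; rewrite inE.
by move=> c; rewrite inE.
Qed.

End FaceCodes.

(** * Uniqueness of the gamma-vector and conclusion *)

Section GammaVector.
Variable d : nat.

(** Triangularity: the i-th basis polynomial has lowest term X^i with coefficient 1, so the j-th
    coefficient of [h] determines [g j] from the earlier entries. *)
Lemma gamma_vector_unique (h : {poly int}) (g g' : {ffun 'I_(d./2).+1 -> int}) :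
  is_gamma_vector h g -> is_gamma_vector h g' -> g = g'.
Proof.
move=> hg hg'; apply/ffunP => j; have [m] := ubnP j; elim: m j => // m IH j jm.
have coefE (f : {ffun 'I_(d./2).+1 -> int}) : is_gamma_vector h f ->
    h`_j = \sum_(i < (d./2).+1 | (i < j)%N) f i * ('X^i * (1 + 'X) ^+ (d - 2 * i))`_j + f j.
  move=> ->; rewrite coef_sum (bigID (fun i : 'I_(d./2).+1 => (i < j)%N)) /=; congr (_ + _).
    by apply: eq_bigr => i _; rewrite coefZ.
  rewrite (bigD1 j) ?ltnn //= coefZ coefXnM ltnn subnn big1 => [|i /andP[ij ne]].
    by rewrite addr0 -horner_coef0 horner_exp hornerD hornerC hornerX addr0 expr1n mulr1.
  rewrite coefZ coefXnM ltn_neqAle eq_sym -val_eqE /= in ne *.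
  by rewrite ne leqNgt ij mulr0.
apply: (@addrI _ (\sum_(i < (d./2).+1 | (i < j)%N) g i * ('X^i * (1 + 'X) ^+ (d - 2 * i))`_j)).
rewrite -coefE // (coefE g') //; congr (_ + _).
by apply: eq_bigr => i ij; rewrite IH //; apply: leq_trans ij _.
Qed.

Lemma gamma_vectorE (h : {poly int}) g : is_gamma_vector h g -> gamma_vector d h = g.
Proof.
move=> hg; apply: (gamma_vector_unique (h := h)) => //.
exact: (@xgetPex _ _ [set g | is_gamma_vector h g]%classic (ex_intro _ g hg)).
Qed.

End GammaVector.

Theorem theorem1p1 (R : realType) (n : nat) (n_ge1 : (1 <= n)%N)
    (p : 'I_n -> R) (p_inj : injective p) (K : {set 'I_n.-1}) :
  (forall j : 'I_((n.-1)./2).+1,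
     gamma_vector n.-1 (h_poly (partitioned_permutohedron p K)) j
       = #|W_hat_des K j|%:Z)
  /\
  h_poly (partitioned_permutohedron p K)
    = \sum_(w in W_hat K) 'X ^+ des w * (1 + 'X) ^+ (n.-1 - 2 * des w).
Proof.
have [tau tauP] := sorts_exists p_inj.
have hE := h_poly_partitioned_permutohedron n_ge1 tauP K.
rewrite sum_step_weight // in hE; split=> // j.
rewrite (@gamma_vectorE _ _ [ffun j : 'I_((n.-1)./2).+1 => #|W_hat_des K j|%:Z]) ?ffunE //.
rewrite /is_gamma_vector hE.
have des_lt w : w \in W_hat K -> (des w < (n.-1)./2.+1)%N by apply: leq_des_hat.
(* The sum is grouped by the number of descents; [des_lt] ensures that [inord] never falls back on
   its default. *)
rewrite (partition_big (fun w => inord (des w) : 'I_((n.-1)./2).+1) xpredT) //=.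
apply: eq_bigr => i _; rewrite ffunE -natz scaler_nat -sumr_const.
apply: eq_big => [w|w /andP[wK /eqP <-]]; last by rewrite inordK ?des_lt.
rewrite [RHS]inE; case: (boolP (w \in W_hat K)) => //= wK.
by rewrite -val_eqE /= inordK ?des_lt.
Qed.
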